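(* Let $p$ be an odd prime and let $G$ be a capable finite $2$-generator $p$-group of nilpotency class two, given by one of the following presentations: (i) $G_1=\langle a,b \mid [a,b]^{p^{\alpha}}=a^{p^{\alpha}}=b^{p^{\alpha}}=[a,b,b]=[a,b,a]=1\rangle$, where $\alpha\ge 1$; (ii) $G_2=\langle a,b \mid [a,b]^{p^{\gamma}}=a^{p^{\alpha}}=b^{p^{\alpha}}=[a,b,b]=[a,b,a]=1\rangle$, where $\alpha>\gamma\ge 1$; (iii) $G_3=\langle a,b \mid [a,b]^{p^{\gamma}}=a^{p^{\alpha}}=[a,b,b]=[a,b,a]=1,\ b^{p^{\beta}}=[a,b]^{p^{\sigma}}\rangle$, where $\alpha\ge\beta\ge\gamma\ge 1$, $\alpha-\beta=\gamma-\sigma$ and $0\le\sigma<\gamma$. Then $$\mathcal{M}^{(2)}(G)\cong\begin{cases}\mathbb{Z}_{p^{\alpha}}^{(5)} & \text{if } G\cong G_1,\\ \mathbb{Z}_{p^{\alpha}}^{(2)}\oplus\mathbb{Z}_{p^{\gamma}}^{(3)} & \text{if } G\cong G_2,\\ \mathbb{Z}_{p^{\alpha}}\oplus\mathbb{Z}_{p^{\beta}}\oplus\mathbb{Z}_{p^{\sigma}}^{(3)} & \text{if } G\cong G_3.\end{cases}$$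
   Context: Commutators are left-normed: $[x,y,z]=[[x,y],z]$. A group $G$ is capable if $G\cong H/Z(H)$ for some group $H$. For a group $G\cong F/R$ with $F$ free and $R$ normal in $F$, the $2$-nilpotent multiplier of $G$ is the abelian group $\mathcal{M}^{(2)}(G)=(R\cap\gamma_3(F))/[R,F,F]$, where $\gamma_3(F)=[F,F,F]$; it is independent (up to isomorphism) of the choice of the free presentation. $\mathbb{Z}_r$ is the cyclic group of order $r$ and $\mathbb{Z}_r^{(t)}$ is the direct sum of $t$ copies of $\mathbb{Z}_r$. *)

(* Defs.v *)
From HB Require Import structures.
From mathcomp Require Import all_boot all_fingroup zmodp all_solvable boolp.

Set Implicit Arguments.
Unset Strict Implicit.
Unset Printing Implicit Defensive.

Local Open Scope group_scope.

(* Groups are arbitrary, possibly infinite, [groupType]s; their subsets are   *)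
(* Prop-valued predicates, since the finite-group library does not apply.     *)

Definition isomorphic (G H : groupType) : Prop :=
  exists f : {multiplicative G -> H}, bijective f.

Section Subgroups.

Variable G : groupType.
Implicit Types (A B S : G -> Prop).

Definition fullG : G -> Prop := fun=> True.

Definition subgroup A : Prop :=
  A 1 /\ forall x y, A x -> A y -> A (x * y^-1).

Definition normal_in A B : Prop :=
  [/\ subgroup A, subgroup B, (forall x, B x -> A x) &
      forall x y, B x -> A y -> B (x ^ y)].

Definition gen_subgroup S : G -> Prop := fun x =>
  forall A, subgroup A -> (forall s, S s -> A s) -> A x.

Definition comm_subgroup A B : G -> Prop :=
  gen_subgroup (fun z => exists x y, [/\ A x, B y & z = [~ x, y]]).

Definition group_center : G -> Prop := fun z => forall x, commute z x.

Lemma subgroup1 A : subgroup A -> A 1. Proof. by case. Qed.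

Lemma subgroupV A x : subgroup A -> A x -> A x^-1.
Proof. by case=> A1 AF Ax; rewrite -[x^-1]mul1g; apply: AF. Qed.

Lemma subgroupM A x y : subgroup A -> A x -> A y -> A (x * y).
Proof.
move=> sA Ax Ay; rewrite -[y]invgK.
by case: (sA) => _; apply=> //; apply: subgroupV.
Qed.

Lemma subgroup_full : subgroup fullG. Proof. by []. Qed.

Lemma subgroupI A B :
  subgroup A -> subgroup B -> subgroup (fun x => A x /\ B x).
Proof.
move=> [A1 AF] [B1 BF]; split=> // x y [Ax Bx] [Ay By].
by split; [apply: AF | apply: BF].
Qed.

Lemma subgroup_gen_subgroup S : subgroup (gen_subgroup S).
Proof.
split=> [A [] // | x y gx gy A sA SA].
by case: (sA) => _; apply; [apply: gx | apply: gy].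
Qed.

Lemma group_center_normal : normal_in fullG group_center.
Proof.
have cJ z y : group_center z -> z ^ y = z by move=> cz; rewrite /conjg cz mulKg.
split; [exact: subgroup_full | split | by [] | by move=> x y cx _; rewrite cJ].
  by move=> x; rewrite /commute mul1g mulg1.
move=> x y cx cy z; rewrite /commute -mulgA; have -> : y^-1 * z = z * y^-1.
  by apply: (mulgI y); rewrite mulKVg mulgA cy mulgK.
by rewrite mulgA (cx z) -mulgA.
Qed.

Lemma normal_comm_subgroup A : normal_in fullG A ->
  normal_in fullG (comm_subgroup A fullG)
  /\ forall x, comm_subgroup A fullG x -> A x.
Proof.
case=> _ sA _ nA; split.
  split=> //; first exact: subgroup_gen_subgroup.
  move=> z y gz _ B sB SB.
  pose C w := B (w ^ y); suff: C z by [].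
  apply: gz; last first.
    move=> _ [u [v [Au _ ->]]]; rewrite /C; apply: SB.
    by exists (u ^ y), (v ^ y); split=> //; [apply: nA | rewrite conjRg].
  split; first by rewrite /C conj1g; apply: subgroup1.
  by move=> u v Cu Cv; rewrite /C conjMg conjVg; case: sB => _; apply.
move=> z gz; apply: gz => // _ [u [v [Au _ ->]]].
by rewrite commgEl; apply: subgroupM => //; [apply: subgroupV | apply: nA].
Qed.

End Subgroups.

Arguments fullG {G}.

Section Quotient.

Variables (G : groupType) (A B : G -> Prop).

Definition lcoset_pred (x : G) : G -> Prop := fun z => B (x^-1 * z).

(* A / B as the type of cosets x B with x in A, under the setwise product of  *)
(* cosets. The phantom argument nBA makes the group structure inferable.      *)
Record quot (nBA : normal_in A B) : Type := Quot {
  quot_set : G -> Prop;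
  quot_setP : exists2 x, A x & quot_set = lcoset_pred x
}.

Variable nBA : normal_in A B.

HB.instance Definition _ := gen_eqMixin (quot nBA).
HB.instance Definition _ := gen_choiceMixin (quot nBA).

Lemma quot_inj (C D : quot nBA) : quot_set C = quot_set D -> C = D.
Proof.
case: C D => [C hC] [D hD] /= eCD; move: hC hD; rewrite eCD => hC hD.
by congr Quot; apply: Prop_irrelevance.
Qed.

Let sA : subgroup A. Proof. by case: nBA. Qed.
Let sB : subgroup B. Proof. by case: nBA. Qed.

Definition setwise_mul (C D : G -> Prop) : G -> Prop := fun z =>
  exists x y, [/\ C x, D y & z = x * y].

Definition setwise_inv (C : G -> Prop) : G -> Prop := fun z => C z^-1.

Lemma lcoset_predM x y : A y ->
  setwise_mul (lcoset_pred x) (lcoset_pred y) = lcoset_pred (x * y).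
Proof.
case: (nBA) => _ _ _ nB Ay; apply/funext=> z; apply/propext; split.
  move=> [u [v [Bu Bv ->]]]; rewrite /lcoset_pred.
  have -> : (x * y)^-1 * (u * v) = (x^-1 * u) ^ y * (y^-1 * v).
    by rewrite /conjg invgM !mulgA mulgK.
  by apply: subgroupM => //; apply: nB.
move=> Bz; exists x, (x^-1 * z); rewrite /lcoset_pred mulVg mulKVg.
by split=> //; [apply: subgroup1 | rewrite mulgA -invgM].
Qed.

Lemma lcoset_predV x : A x ->
  setwise_inv (lcoset_pred x) = lcoset_pred x^-1.
Proof.
case: (nBA) => _ _ _ nB Ax; apply/funext=> z; apply/propext.
rewrite /setwise_inv /lcoset_pred invgK; split=> Bz.
  have := nB _ _ (subgroupV sB Bz) (subgroupV sA Ax).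
  by rewrite /conjg invgM !invgK mulgK.
have := nB _ _ (subgroupV sB Bz) Ax.
by rewrite /conjg invgM mulgKV.
Qed.

Lemma quot_one_subproof : exists2 x, A x & lcoset_pred 1 = lcoset_pred x.
Proof. by exists 1 => //; apply: subgroup1. Qed.

Lemma quot_mul_subproof (C D : quot nBA) :
  exists2 x, A x &
    setwise_mul (quot_set C) (quot_set D) = lcoset_pred x.
Proof.
case: C D => [C [x Ax eC]] [D [y Ay eD]] /=.
by exists (x * y); [apply: subgroupM | rewrite eC eD lcoset_predM].
Qed.

Lemma quot_inv_subproof (C : quot nBA) :
  exists2 x, A x & setwise_inv (quot_set C) = lcoset_pred x.
Proof.
case: C => [C [x Ax eC]] /=.
by exists x^-1; [apply: subgroupV | rewrite eC lcoset_predV].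
Qed.

Definition quot_one : quot nBA := Quot nBA quot_one_subproof.
Definition quot_mul (C D : quot nBA) : quot nBA :=
  Quot nBA (quot_mul_subproof C D).
Definition quot_inv (C : quot nBA) : quot nBA := Quot nBA (quot_inv_subproof C).

Lemma quot_mulA : associative quot_mul.
Proof.
move=> [C [x Ax eC]] [D [y Ay eD]] [E [z Az eE]]; apply: quot_inj => /=.
by rewrite eC eD eE !lcoset_predM ?mulgA //; apply: subgroupM.
Qed.

Lemma quot_mul1 : left_id quot_one quot_mul.
Proof.
move=> [C [x Ax eC]]; apply: quot_inj => /=.
by rewrite eC lcoset_predM ?mul1g.
Qed.

Lemma quot_1mul : right_id quot_one quot_mul.
Proof.
move=> [C [x Ax eC]]; apply: quot_inj => /=.
by rewrite eC lcoset_predM ?mulg1 //; apply: subgroup1.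
Qed.

Lemma quot_mulV : left_inverse quot_one quot_inv quot_mul.
Proof.
move=> [C [x Ax eC]]; apply: quot_inj => /=.
by rewrite eC lcoset_predV // lcoset_predM ?mulVg.
Qed.

Lemma quot_Vmul : right_inverse quot_one quot_inv quot_mul.
Proof.
move=> [C [x Ax eC]]; apply: quot_inj => /=.
by rewrite eC lcoset_predV // lcoset_predM ?mulgV //; apply: subgroupV.
Qed.

HB.instance Definition _ := isGroup.Build (quot nBA)
  quot_mulA quot_mul1 quot_1mul quot_mulV quot_Vmul.

End Quotient.

Definition capable (G : groupType) : Prop :=
  exists H : groupType, isomorphic G (quot (group_center_normal H)).

(* Freeness by the universal property of a basis iota : X -> F.               *)
Definition free_group (F : groupType) : Prop :=
  exists (X : Type) (iota : X -> F),
    forall (H : groupType) (f : X -> H),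
      exists2 phi : {multiplicative F -> H}, phi \o iota =1 f &
        forall psi : {multiplicative F -> H}, psi \o iota =1 f -> psi =1 phi.

Section Multiplier.

Variables (F : groupType) (R : F -> Prop).

Definition gamma3 : F -> Prop :=
  comm_subgroup (comm_subgroup fullG fullG) fullG.

Definition commRFF : F -> Prop := comm_subgroup (comm_subgroup R fullG) fullG.

Lemma comm_subgroupS (A B A' : F -> Prop) :
  (forall x, A x -> A' x) ->
  forall x, comm_subgroup A B x -> comm_subgroup A' B x.
Proof.
move=> sAA' x gx C sC CA'; apply: gx => // _ [u [v [Au Bv ->]]].
by apply: CA'; exists u, v; split=> //; apply: sAA'.
Qed.

Lemma commRFF_normal : normal_in fullG R ->
  normal_in (fun x => R x /\ gamma3 x) commRFF.
Proof.
move=> nR; have [nRF sRFR] := normal_comm_subgroup nR.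
have [[_ sRFF _ nRFF] sRFFRF] := normal_comm_subgroup nRF.
split=> //.
- by case: nR => _ sR _ _; apply: subgroupI => //; apply: subgroup_gen_subgroup.
- move=> x Rx; split; first exact: sRFR (sRFFRF _ Rx).
  by apply: comm_subgroupS x Rx => y; apply: comm_subgroupS.
- by move=> x y Rx _; apply: nRFF.
Qed.

End Multiplier.

(* M^(2)(F / R) = (R n gamma_3(F)) / [R, F, F]. *)
Definition two_nilpotent_multiplier (F : groupType) (R : F -> Prop)
    (nR : normal_in fullG R) : groupType :=
  quot (commRFF_normal nR).

(* The additive group of integers mod r, for r > 0; not 'Z_r, since 'Z_1 has  *)
(* two elements and r = 1 occurs. The multiplicative law of the underlying    *)
(* groupType is addition mod r.                                               *)
Definition cyclic_group (r : nat) : groupType := 'I_r.-1.+1.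

Definition cyclic_power (r t : nat) : groupType :=
  {ffun 'I_t -> cyclic_group r}.

(* Main.v *)
From HB Require Import structures.
Require Import Defs.
From mathcomp Require Import all_boot all_fingroup all_algebra all_solvable.
From mathcomp Require Import zmodp boolp ring zify.

(* Since G has class two, M^(2)(G) = gamma_3(Q) for Q = F/[R,F,F], and R maps *)
(* into the second center of Q. If a, b lift generators of G, then with       *)
(* c = [a,b], u = [c,a], w = [c,b] the group gamma_3(Q) is abelian, generated *)
(* by u, w, [u,a], [u,b] = [w,a], [w,b]; the relators of G, being in the      *)
(* second center, bound the orders of u, w, [u,a] u^(p^(beta-sigma)), [u,b],  *)
(* [w,b] by p^alpha, p^beta, p^sigma, p^sigma, p^sigma. The first two         *)
(* presentations are the case beta = alpha, sigma = gamma of the third one,   *)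
(* up to a trivial change of the last relation.                               *)
(* For the lower bound, if a finite group E = <x, y> satisfies the relations  *)
(* of G modulo its second center, then G -> E/Z_2(E) lifts to F -> E because  *)
(* F is free, and the lift kills [R,F,F]. Suitable E are generated by two     *)
(* affine maps z |-> z (1 + d N) + e of a finite commutative ring in which    *)
(* N^4 = 0.                                                                   *)

Set Implicit Arguments.
Unset Strict Implicit.
Unset Printing Implicit Defensive.

Import GRing.Theory.
Local Open Scope group_scope.

(** As G has class two, R contains gamma_3(F), so the multiplier is gamma_3(Q), where Q = F/[R,F,F]
    is generated by a, b and its second center. All three presentations are treated as one, with the
    relator r = b^(p^beta) [a,b]^(-p^sigma).

    Upper bound. The second center centralizes every commutator. Letting relators act on c = [a,b],
    and taking commutators of relators with a and b, gives the relations of [weight4_relations]. One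
    of them ties u^(p^beta) to [u,a]^(p^sigma); replacing [u,a] by v = [u,a] u^(p^(beta-sigma))
    turns it into v^(p^sigma) = 1. Hence the words in u, w, v, [u,b], [w,b] define a homomorphism
    ([model_wordM]) from the direct sum onto gamma_3(Q) ([gamma3_model_word]).

    Lower bound. Let a finite group E contain a pair satisfying the relations of G modulo the second
    center. By [lift_mod_second_center] some map F -> E sends a, b to that pair up to second-central
    factors, and by [commRFF_kernel] it kills [R,F,F]. Such factors do not change the words
    ([gamma3_word_mod]), so a word trivial in Q is trivial in E. The affine groups of [model_u_t1],
    [model_w], [model_t3] and [model_t2] then force each exponent to be divisible by the order of
    its cyclic factor, and [multiplier_iso] concludes. *)

Section CommutatorCalculus.

(** * Commutator identities and the second center *)

Variable G : groupType.
Implicit Types (x y z g : G) (S : G -> Prop).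

Let gsimp := (@invgM G, @invgK G, @mulgA G, @mulgK G, @mulgVK G, @mulVg G,
  @mulgV G, @mul1g G, @mulg1 G).

Lemma commMg_conj x y g : [~ x * y, g] = [~ x, g] ^ y * [~ y, g].
Proof. by rewrite /commg /conjg !gsimp. Qed.

Lemma commgM_conj x g h : [~ x, g * h] = [~ x, h] * [~ x, g] ^ h.
Proof. by rewrite /commg /conjg !gsimp. Qed.

Lemma commgV_conj x g : [~ x, g^-1] = [~ x, g]^-1 ^ g^-1.
Proof. by rewrite /commg /conjg !gsimp. Qed.

Lemma conjg_comm x g : x ^ g = x * [~ x, g].
Proof. by rewrite commgEl mulVKg. Qed.

Lemma conjg_id x g : commute x g -> x ^ g = x.
Proof. by move=> cxg; rewrite /conjg cxg mulKg. Qed.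

(** Conjugation by [g] acts on x, y, z like a unipotent Jordan block, whose powers have binomial
    entries. *)
Lemma conjg_expgn g x y z n :
    commute x y -> commute x z -> commute y z ->
    x ^ g = x * y -> y ^ g = y * z -> z ^ g = z ->
  x ^ (g ^+ n) = x * y ^+ n * z ^+ 'C(n, 2).
Proof.
move=> cxy cxz cyz xg yg zg; elim: n => [|n IHn].
  by rewrite conjg1 !mulg1.
rewrite expgSr conjgM IHn !conjMg !conjXg xg yg zg expgMn // binS bin1.
by rewrite addnC expgnDr expgS !mulgA.
Qed.

(** Moving every [b] to the left leaves the conjugates of [d] by powers of [b]; their binomial
    exponents add up by Pascal's rule. *)
Lemma expMg_conj b d y z m :
    commute d y -> commute d z -> commute y z ->
    d ^ b = d * y -> y ^ b = y * z -> z ^ b = z ->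
  (b * d) ^+ m = b ^+ m * (d ^+ m * y ^+ 'C(m, 2) * z ^+ 'C(m, 3)).
Proof.
move=> cdy cdz cyz db yb zb; elim: m => [|m IHm]; first by rewrite !mulg1.
rewrite expgSr IHm; set W := d ^+ m * _ * _.
have -> : b ^+ m * W * (b * d) = b ^+ m.+1 * (W ^ b * d).
  by rewrite expgSr /conjg !gsimp.
congr (_ * _).
have -> : W ^ b = d ^+ m * (y ^+ 'C(m.+1, 2) * z ^+ 'C(m.+1, 3)).
  rewrite /W !conjMg !conjXg db yb zb !expgMn //.
  rewrite !binS bin1 -!mulgA; congr (_ * _).
  rewrite [_ + m]addnC ['C(m, 3) + _]addnC.
  by rewrite !expgnDr -!mulgA.
rewrite expgSr -!mulgA; congr (_ * _); rewrite mulgA.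
by apply/commute_sym/commuteM; apply: commuteX.
Qed.

Definition second_center z := forall x y, [~ z, x, y] = 1.

Lemma second_center_comm z x : second_center z -> group_center [~ z, x].
Proof. by move=> z2 y; apply/commgP/eqP. Qed.

(** For z in the second center, g |-> [z,g] is a homomorphism into the center, which is abelian, so
    it kills commutators. *)
Lemma second_center_commute z x y : second_center z -> commute z [~ x, y].
Proof.
move=> z2; have cz g h : [~ z, g] ^ h = [~ z, g].
  exact/conjg_id/second_center_comm.
have zM g h : z ^ (g * h) = z * ([~ z, h] * [~ z, g]).
  rewrite conjgM [z ^ g]conjg_comm conjMg cz conjg_comm. by rewrite -mulgA.
have zC g h : z ^ (g * h) = z ^ (h * g).
  by rewrite !zM; congr (_ * _); exact: (second_center_comm h z2 [~ z, g]).
apply/commgP; rewrite -conjg_fix; apply/eqP.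
have -> : [~ x, y] = x^-1 * y^-1 * (x * y) by rewrite /commg /conjg !gsimp.
by rewrite conjgM zC -invgM conjgKV.
Qed.

Lemma center_commute z x : group_center z -> commute x z.
Proof. by move=> /(_ x)/commute_sym. Qed.

Lemma center_conjg z x : group_center z -> z ^ x = z.
Proof. by move=> /(_ x)/conjg_id. Qed.

Lemma group_centerV z : group_center z -> group_center z^-1.
Proof. by move=> zZ x; apply/commute_sym/commuteV/center_commute. Qed.

Lemma second_center_eq z x y :
  second_center z -> z ^ x = z * y -> group_center y.
Proof.
by move=> z2; rewrite conjg_comm => /mulgI <-; apply: second_center_comm.
Qed.

Lemma conjg_mul_expg z x y n : z ^ x = z * y -> commute z y ->
  (z ^+ n) ^ x = z ^+ n * y ^+ n.
Proof. by move=> zx zy; rewrite conjXg zx expgMn. Qed.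

Lemma expg_eq1_center z x y n : z ^ x = z * y -> group_center y ->
  group_center (z ^+ n) -> y ^+ n = 1.
Proof.
move=> zx yZ /(center_conjg x); rewrite (conjg_mul_expg _ zx); last first.
  exact: center_commute.
by rewrite -{2}[z ^+ n]mulg1 => /mulgI.
Qed.

Lemma expg_dvd z m n : m %| n -> z ^+ m = 1 -> z ^+ n = 1.
Proof. by move=> /dvdnP[k ->] zm; rewrite mulnC expgnA zm expg1n. Qed.

End CommutatorCalculus.

(** * Relations between commutators of weight three and four *)

Section WeightFourRelations.

Variables (Q : groupType) (a b c u w t1 t2 t2' t3 : Q).
Hypotheses (abC : a * b = b * a * c) (ca : c ^ a = c * u) (cb : c ^ b = c * w).
Hypotheses (ua : u ^ a = u * t1) (ub : u ^ b = u * t2).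
Hypotheses (wa : w ^ a = w * t2') (wb : w ^ b = w * t3).
Hypotheses (ccu : commute c u) (ccw : commute c w) (cuw : commute u w).
Hypotheses (t1Z : group_center t1) (t2Z : group_center t2).
Hypotheses (t2Z' : group_center t2') (t3Z : group_center t3).

Let cc := @center_commute Q.
Let cJ := @center_conjg Q.

(** A case of the Hall-Witt identity: c is conjugated by both sides of a b = b a c. *)
Lemma weight4_comm_sym : t2' = t2.
Proof.
have eab : c ^ (a * b) = c * w * (u * t2) by rewrite conjgM ca conjMg cb ub.
have eba : c ^ (b * a * c) = c * u * (w * t2').
  rewrite !conjgM cb conjMg ca wa conjg_id //.
  by apply/commute_sym; apply: commuteM; apply: commuteM => //; apply: cc.
move: eba; rewrite -abC eab -!mulgA => /mulgI.
by rewrite !mulgA -cuw -!mulgA => /mulgI/mulgI.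
Qed.

Variables (nal nbe nga nsi : nat).
Hypotheses (a2 : second_center (a ^+ nal)) (c2 : second_center (c ^+ nga)).
Hypothesis (b2 : second_center (b ^+ nbe * c ^- nsi)).
Hypotheses (bin_al : nal %| 'C(nal, 2)) (bin_be : nbe %| 'C(nbe, 2)).
Hypotheses (ga_al : nga %| nal) (ga_be : nga %| nbe).

Let cE : c = [~ a, b].
Proof. by apply: (mulgI (b * a)); rewrite -abC -commgC. Qed.

(** Since [c ^+ nga] is in the second center, its commutators [u ^+ nga] and [w ^+ nga] are central,
    and one more commutator gives 1. *)
Lemma order_t : [/\ t1 ^+ nga = 1, t2 ^+ nga = 1 & t3 ^+ nga = 1].
Proof.
have uZ := second_center_eq c2 (conjg_mul_expg nga ca ccu).
have wZ := second_center_eq c2 (conjg_mul_expg nga cb ccw).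
by split; [apply: expg_eq1_center ua _ uZ | apply: expg_eq1_center ub _ uZ
          | apply: expg_eq1_center wb _ wZ].
Qed.

(** The second-central [a ^+ nal] fixes the commutator c. Expanding the conjugate leaves [u ^+ nal]
    and a power of [t1], trivial because [nga] divides ['C(nal, 2)]. *)
Lemma order_u : u ^+ nal = 1.
Proof.
have [ot1 _ _] := order_t.
have cal : c ^ (a ^+ nal) = c.
  by rewrite cE; apply/conjg_id/commute_sym/second_center_commute.
have := conjg_expgn nal ccu (cc _ t1Z) (cc _ t1Z) ca ua (cJ _ t1Z).
rewrite cal (expg_dvd _ ot1) ?mulg1; last exact: dvdn_trans bin_al.
by rewrite -{1}[c]mulg1 => /mulgI.
Qed.

(** As for [order_u]: [b ^+ nbe] is the relator times [c ^+ nsi], and both commute with c. *)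
Lemma order_w : w ^+ nbe = 1.
Proof.
have [_ _ ot3] := order_t.
have cr : c ^ (b ^+ nbe) = c.
  have := second_center_commute a b b2; rewrite -cE => /commute_sym crc.
  apply: conjg_id; rewrite -[b ^+ nbe](mulgK (c ^- nsi)) invgK.
  by apply: commuteM => //; apply: commuteX.
have := conjg_expgn nbe ccw (cc _ t3Z) (cc _ t3Z) cb wb (cJ _ t3Z).
rewrite cr (expg_dvd _ ot3) ?mulg1; last exact: dvdn_trans bin_be.
by rewrite -{1}[c]mulg1 => /mulgI.
Qed.

(** The commutator of the relator with b is [w ^- nsi], so [w ^+ nsi] is central. *)
Lemma order_t2_t3 : t2 ^+ nsi = 1 /\ t3 ^+ nsi = 1.
Proof.
have rb : (b ^+ nbe * c ^- nsi) ^ b = b ^+ nbe * c ^- nsi * w ^- nsi.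
  rewrite conjMg conjVg (conjg_mul_expg _ cb) // invgM.
  rewrite [_ ^ b]conjg_id; last exact/commute_sym/commuteX.
  rewrite -mulgA.
  by congr (_ * _); apply/commuteV/commute_sym/commuteV/commuteX2.
have wZ : group_center (w ^+ nsi).
  move=> x; apply/commute_sym; rewrite -[_ ^+ _]invgK.
  exact/commuteV/cc/(second_center_eq b2 rb).
by split; [rewrite -weight4_comm_sym; apply: expg_eq1_center wa _ wZ
          | apply: expg_eq1_center wb _ wZ].
Qed.

(** The commutator [y] of the relator with a is central, hence fixed by a. It is
    [c ^- nbe * u ^- nsi] up to a central factor, and conjugation by a changes this by the inverse
    of the left-hand side. *)
Lemma order_ut1 : u ^+ nbe * t1 ^+ nsi = 1.
Proof.
have dw : commute c^-1 w^-1 by apply/commuteV/commute_sym/commuteV/commute_sym.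
have cV := @group_centerV Q.
(* Here [b ^ a = b * c^-1]. In the expansion of its power the factor in [w] dies by [order_w]; the
   one in [t3] is kept, being central. *)
have ba : (b ^+ nbe) ^ a = b ^+ nbe * (c ^- nbe * t3^-1 ^+ 'C(nbe, 3)).
  have -> : (b ^+ nbe) ^ a = (b * c^-1) ^+ nbe.
    rewrite conjXg; congr (_ ^+ _).
    by apply: (mulgI a); rewrite -conjgC mulgA abC mulgK.
  have db : c^-1 ^ b = c^-1 * w^-1.
    by rewrite conjVg cb invgM dw.
  have yb : w^-1 ^ b = w^-1 * t3^-1.
    by rewrite conjVg wb invgM; apply: cV.
  rewrite (expMg_conj _ dw (cc _ (cV _ t3Z)) (cc _ (cV _ t3Z)) db yb).
    by rewrite !expVgn (expg_dvd bin_be order_w) invg1 mulg1.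
  exact/cJ/cV.
set ba_z := t3^-1 ^+ _ in ba.
have zZ : group_center ba_z.
  by move=> x; apply/commute_sym/commuteX/cc/cV.
set y := c ^- nbe * ba_z * u ^- nsi.
have cy : commute (c ^+ nsi) y.
  apply: commuteM; first apply: commuteM; last exact/commuteV/commuteX2.
    by apply/commuteV/commuteX2.
  exact: cc.
have ra : (b ^+ nbe * c ^- nsi) ^ a = b ^+ nbe * c ^- nsi * y.
  rewrite conjMg conjVg ba (conjg_mul_expg _ ca) // invgM.
  rewrite mulgA -[in LHS](mulgA _ _ (u ^- _)) -/y -!(mulgA (b ^+ _)).
  by congr (_ * _); apply/commuteV/commute_sym.
have := cJ a (cV _ (second_center_eq b2 ra)).
rewrite !invgM !invgK !conjMg conjVg (cJ a zZ).
rewrite (conjg_mul_expg _ ua); last exact: cc.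
rewrite (conjg_mul_expg _ ca) //.
have tC x : commute (t1 ^+ nsi) x by apply/commute_sym/commuteX/cc.
rewrite -mulgA tC => /mulgI; rewrite -!mulgA => /mulgI.
by rewrite -[in RHS](mulg1 (c ^+ nbe)) => /mulgI.
Qed.
End WeightFourRelations.

Lemma weight4_relations (Q : groupType) (a b : Q) (nal nbe nga nsi : nat) :
    second_center (a ^+ nal) -> second_center ([~ a, b] ^+ nga) ->
    second_center [~ a, b, a] -> second_center [~ a, b, b] ->
    second_center (b ^+ nbe * [~ a, b] ^- nsi) ->
    nal %| 'C(nal, 2) -> nbe %| 'C(nbe, 2) -> nga %| nal -> nga %| nbe ->
  [/\ [~ a, b, a] ^+ nal = 1, [~ a, b, b] ^+ nbe = 1,
      [~ a, b, a, b] ^+ nsi = 1 /\ [~ a, b, b, b] ^+ nsi = 1,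
      [~ a, b, a] ^+ nbe * [~ a, b, a, a] ^+ nsi = 1
    & [~ a, b, b, a] = [~ a, b, a, b]].
Proof.
move=> a2 c2 u2 w2 b2 bin_al bin_be ga_al ga_be.
have abC := commgC a b; have J := @conjg_comm Q.
have ccu := commute_sym (second_center_commute a b u2).
have ccw := commute_sym (second_center_commute a b w2).
have cuw := second_center_commute [~ a, b] b u2.
have uZ x := second_center_comm x u2; have wZ x := second_center_comm x w2.
split.
- exact: (order_u abC (J _ a) (J _ b) (J _ a) (J _ b) (J _ b) ccu ccw (uZ a)
    (uZ b) (wZ b) a2 c2).
- exact: (order_w abC (J _ a) (J _ b) (J _ a) (J _ b) (J _ b) ccu ccw (uZ a)
    (uZ b) (wZ b) c2 b2).
- exact: (order_t2_t3 abC (J _ a) (J _ b) (J _ b) (J _ a) (J _ b) ccu ccw cuw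
    (wZ a) (wZ b) b2).
- exact: (order_ut1 abC (J _ a) (J _ b) (J _ a) (J _ b) (J _ b) ccu ccw (uZ a)
    (uZ b) (wZ b) c2 b2).
- exact: (weight4_comm_sym abC (J _ a) (J _ b) (J _ b) (J _ a) ccu ccw cuw
    (wZ a)).
Qed.

(** * Generators of gamma_3 *)

Section CommutatorSubgroups.

Variables (G : groupType) (S : G -> Prop).
Hypotheses (sS : subgroup S) (nS : forall s g, S s -> S (s ^ g)).

Lemma subgroup_comm_right x : subgroup (fun h => S [~ x, h]).
Proof.
split=> [|g h Sg Sh]; first by rewrite commg1; apply: subgroup1.
rewrite commgM_conj commgV_conj.
by apply: subgroupM => //; apply: nS => //; apply: subgroupV.
Qed.

Lemma comm_swap x y : S [~ x, y] -> S [~ y, x].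
Proof. by rewrite -[ [~ y, x] ]invgR; apply: subgroupV. Qed.

(** For S a normal subgroup, the preimage of the center of G/S. *)
Definition relative_center z := forall h, S [~ z, h].

Lemma relative_center_subgroup : subgroup relative_center.
Proof.
split=> [h | x y Zx Zy h]; first by rewrite comm1g; apply: subgroup1.
by apply/comm_swap/(subgroup_comm_right h).2; apply: comm_swap.
Qed.

Lemma relative_center_conj z g : relative_center z -> relative_center (z ^ g).
Proof.
by move=> Zz h; rewrite -[h](conjgKV g) -conjRg; apply/nS/Zz.
Qed.

End CommutatorSubgroups.

Section TwoGeneratorsModSecondCenter.

Variables (G : groupType) (a b : G).
Hypothesis genG : forall P : G -> Prop, subgroup P -> P a -> P b ->
  (forall r, second_center r -> P r) -> forall g, P g.

(** In G/S the commutator [a,b] is central, so a and b commute modulo the center. Elements of the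
    second center of G commute with everything there, so G/S has class at most two. *)
Lemma triple_comm_sub (S : G -> Prop) :
    subgroup S -> (forall s g, S s -> S (s ^ g)) ->
    S [~ a, b, a] -> S [~ a, b, b] ->
  forall g, gamma3 g -> S g.
Proof.
move=> sS nS Sa Sb t t3.
have sN := relative_center_subgroup sS nS; have nN := relative_center_conj nS.
have N1 : relative_center S 1 by case: sN.
have Nr x r : second_center r -> relative_center S [~ x, r].
  move=> r2; apply: (comm_swap sN) => h; rewrite r2; exact: subgroup1.
have Nc : relative_center S [~ a, b].
  move=> h; apply: (genG (subgroup_comm_right sS nS [~ a, b])) => // r r2.
  have /commute_sym/commgP/eqP -> := second_center_commute a b r2.
  exact: subgroup1.
have Na y : relative_center S [~ a, y].
  apply: (genG (subgroup_comm_right sN nN a)) => //; last by move=> r /Nr.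
  by rewrite commgg.
have Nb y : relative_center S [~ b, y].
  apply: (genG (subgroup_comm_right sN nN b)) => //; last by move=> r /Nr.
    exact: (comm_swap sN).
  by rewrite commgg.
have Nxy x z : relative_center S [~ x, z].
  apply: (comm_swap sN).
  apply: (genG (subgroup_comm_right sN nN z)) => //; last by move=> r /Nr.
    exact: (comm_swap sN).
  exact: (comm_swap sN).
apply: t3 => // _ [z [h [z2 _ ->]]].
by apply: (z2 _ sN) => // _ [x [x' [_ _ ->]]].
Qed.

Hypotheses (u2 : second_center [~ a, b, a]) (w2 : second_center [~ a, b, b]).

(** The subgroup [T] generated by the six commutators is normal: conjugation multiplies those of
    weight three by products of those of weight four, which are central. So [triple_comm_sub]
    applies to [T]. *)
Lemma triple_comm_sub_gen (S : G -> Prop) : subgroup S ->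
    S [~ a, b, a] -> S [~ a, b, b] -> S [~ a, b, a, a] -> S [~ a, b, a, b] ->
    S [~ a, b, b, a] -> S [~ a, b, b, b] ->
  forall g, gamma3 g -> S g.
Proof.
move=> sS Su Sw Sua Sub Swa Swb y y3.
pose E e := [\/ e = [~ a, b, a], e = [~ a, b, b] |
  [\/ e = [~ a, b, a, a], e = [~ a, b, a, b],
      e = [~ a, b, b, a] | e = [~ a, b, b, b]]].
have sT := subgroup_gen_subgroup E; set T := gen_subgroup E in sT.
have ET e : E e -> T e by move=> Ee A _; apply.
suff : T y by apply=> // e [||[]] ->.
have Tu : T [~ a, b, a] by apply: ET; apply: Or31.
have Tw : T [~ a, b, b] by apply: ET; apply: Or32.
have Tua : T [~ a, b, a, a] by apply: ET; apply/Or33/Or41.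
have Tub : T [~ a, b, a, b] by apply: ET; apply/Or33/Or42.
have Twa : T [~ a, b, b, a] by apply: ET; apply/Or33/Or43.
have Twb : T [~ a, b, b, b] by apply: ET; apply/Or33/Or44.
have T2 p q : second_center [~ p, q] -> T [~ p, q] -> T [~ p, q, a] ->
    T [~ p, q, b] -> forall g, T ([~ p, q] ^ g).
  move=> e2 Te Tea Teb g; rewrite conjg_comm; apply: (subgroupM sT) => //.
  have cJ h k : [~ p, q, h] ^ k = [~ p, q, h].
    exact/center_conjg/second_center_comm.
  (* The map g |-> [p,q,g] is a homomorphism into the center, so generators suffice. *)
  apply: (genG (P := fun g => T [~ p, q, g])) => // [|r r2]; last first.
    have /commute_sym/commgP/eqP -> := second_center_commute p q r2.
    exact: (subgroup1 sT).
  split=> [|h k Th Tk]; first by rewrite commg1; apply: (subgroup1 sT).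
  rewrite commgM_conj commgV_conj conjVg !cJ.
  by apply: (subgroupM sT) => //; apply: (subgroupV sT).
have sA : subgroup (fun s => forall g, T (s ^ g)).
  split=> [g | s t As At g]; first by rewrite conj1g; apply: (subgroup1 sT).
  by rewrite conjMg conjVg; apply: (subgroupM sT) => //; apply: (subgroupV sT).
have TZ (e g : G) : group_center e -> T e -> T (e ^ g).
  by move=> eZ; rewrite center_conjg.
have uZ h : group_center [~ a, b, a, h] by apply: second_center_comm.
have wZ h : group_center [~ a, b, b, h] by apply: second_center_comm.
have nT s g : T s -> T (s ^ g).
  move=> Ts; move: g; apply: Ts sA _ => e Ee g.
  by case: Ee => [||[]] ->; first [exact: T2 | exact: TZ].
exact: triple_comm_sub.
Qed.

End TwoGeneratorsModSecondCenter.

(** * Homomorphisms and words in gamma_3 *)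

Section MultiplicativeMaps.

Variables (G H : groupType) (f : {multiplicative G -> H}).

Lemma multiplicative1 : f 1 = 1.
Proof. by apply: (mulgI (f 1)); rewrite -gmulfM !mulg1. Qed.

Lemma multiplicativeV x : f x^-1 = (f x)^-1.
Proof. by apply: (mulgI (f x)); rewrite -gmulfM !mulgV multiplicative1. Qed.

Lemma multiplicativeX x n : f (x ^+ n) = f x ^+ n.
Proof.
by elim: n => [|n IHn]; rewrite ?multiplicative1 // !expgS gmulfM IHn.
Qed.

Lemma multiplicativeR x y : f [~ x, y] = [~ f x, f y].
Proof. by rewrite /commg /conjg !gmulfM !multiplicativeV. Qed.

End MultiplicativeMaps.

Section Words.

Variables (P i j k l m : nat).

(** A normal form for elements of gamma_3. For P = p^(beta-sigma) the twist in the third factor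
    makes its p^sigma-th power trivial, by [order_ut1]. *)
Definition gamma3_word (G : groupType) (x y : G) : G :=
  [~ x, y, x] ^+ i * [~ x, y, y] ^+ j *
  ([~ x, y, x, x] * [~ x, y, x] ^+ P) ^+ k *
  [~ x, y, x, y] ^+ l * [~ x, y, y, y] ^+ m.

Lemma gmulf_gamma3_word (G H : groupType) (f : {multiplicative G -> H}) x y :
  f (gamma3_word x y) = gamma3_word (f x) (f y).
Proof.
by rewrite /gamma3_word !(gmulfM, multiplicativeX, multiplicativeR).
Qed.

Lemma comm_modr (G : groupType) (p q g z : G) : second_center z ->
  [~ p, q, g * z] = [~ p, q, g].
Proof.
move=> z2; rewrite commgM_conj (conjg_id (commute_sym _)); last first.
  exact: second_center_commute.
have /commute_sym/commgP/eqP -> := second_center_commute p q z2.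
by rewrite mul1g.
Qed.

Lemma comm_modlr (G : groupType) (g h z z' : G) :
    second_center z -> second_center z' ->
  exists2 y, group_center y & [~ g * z, h * z'] = [~ g, h] * y.
Proof.
move=> z2 z2'.
have zh := second_center_comm h z2; have z'g := second_center_comm (g * z) z2'.
exists ([~ z, h] * [~ g * z, z']).
  move=> x; apply/commute_sym/commuteM; first exact: center_commute.
  by rewrite -invgR; apply/center_commute/group_centerV.
rewrite commgM_conj (commMg_conj g z h) conjMg (center_conjg _ zh).
rewrite !conjg_id; try exact/commute_sym/second_center_commute.
rewrite -invgR; apply/esym; rewrite mulgA; exact/center_commute/group_centerV.
Qed.

(** The factors [z] and [z'] change [g,h] by a central element only, and they commute with
    commutators. *)
Lemma gamma3_word_mod (G : groupType) (g h z z' : G) :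
    second_center z -> second_center z' ->
  gamma3_word (g * z) (h * z') = gamma3_word g h.
Proof.
move=> z2 z2'; have [y yZ c_eq] := comm_modlr g h z2 z2'.
have cM e : [~ [~ g, h] * y, e] = [~ g, h, e].
  rewrite commMg_conj conjg_id; last exact/center_commute.
  by have /commgP/eqP -> := yZ e; rewrite mulg1.
by rewrite /gamma3_word c_eq !cM !comm_modr.
Qed.

End Words.

(** * The second center of a group with given generators *)

Lemma second_center_gen (G : groupType) (x y z : G) :
    (forall P : G -> Prop, subgroup P -> P x -> P y -> forall g, P g) ->
    [~ z, x, x] = 1 -> [~ z, x, y] = 1 -> [~ z, y, x] = 1 -> [~ z, y, y] = 1 ->
  second_center z.
Proof.
move=> genG zxx zxy zyx zyy.
have [_ sZ _ nZ] := group_center_normal G.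
have sC (e : G) : subgroup (commute e).
  split=> [|g h eg eh]; first exact: commute1.
  by apply: commuteM => //; apply: commuteV.
have Zx : group_center [~ z, x].
  by apply: (genG _ (sC _)); apply/commgP/eqP.
have Zy : group_center [~ z, y].
  by apply: (genG _ (sC _)); apply/commgP/eqP.
move=> g h; apply/eqP/commgP; move: h; rewrite -/(group_center _).
by apply: (genG _ (subgroup_comm_right sZ _ z)) => // s k Zs; apply: nZ.
Qed.

Lemma gen_ind (E : finGroupType) (A : {set E}) (P : E -> Prop) :
    <<A>> = [set: E] -> subgroup P -> (forall e, e \in A -> P e) ->
  forall g, P g.
Proof.
move=> genA sP PA g; pose B := [set e : E | `[<P e>]].
have gB : group_set B.
  apply/group_setP; split=> [|x y]; rewrite !inE.
    by apply/asboolP; apply: (subgroup1 sP).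
  by move=> /asboolP Px /asboolP Py; apply/asboolP/(subgroupM sP).
have : g \in Group gB.
  have /subsetP : <<A>> \subset Group gB.
    by rewrite gen_subG; apply/subsetP=> e /PA Pe; rewrite inE; apply/asboolP.
  by apply; rewrite genA inE.
by rewrite inE => /asboolP.
Qed.

Lemma ucn2_second_center (E : finGroupType) (z : E) :
  z \in 'Z_2([set: E]) <-> second_center z.
Proof.
rewrite ucnSnR ucn1 !inE /=; split=> [sZ x y | z2].
  have : [~ z, x] \in 'Z([set: E]).
    by apply: (subsetP sZ); rewrite mem_commg ?inE.
  by case/centerP=> _ /(_ y)/(_ (in_setT y))/commgP/eqP.
rewrite gen_subG; apply/subsetP=> _ /imset2P[_ x /set1P -> _ ->].
by apply/centerP; split=> [|y _]; [rewrite inE | apply/commgP/eqP].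
Qed.

(** * Presentations as universal properties *)

Section Presentations.

Variables (nal nbe nga nsi : nat).

Definition relations (G : groupType) (x y : G) : Prop :=
  [/\ x ^+ nal = 1, [~ x, y] ^+ nga = 1, [~ x, y, x] = 1, [~ x, y, y] = 1
    & y ^+ nbe = [~ x, y] ^+ nsi].

Definition presented (G : finGroupType) : Prop :=
  forall (rT : finGroupType) (H : {group rT}), H \homg [set: G] <->
    exists x y : rT, <<[set x; y]>> = H /\ relations x y.

(** Von Dyck's property, for finite targets. *)
Definition universal_pair (G : finGroupType) (a b : G) : Prop :=
  forall (E : finGroupType) (x y : E), relations x y ->
    exists f : {multiplicative G -> E}, f a = x /\ f b = y.

Lemma pairX (G H : finGroupType) (x : G) (y : H) n :
  ((x, y) : (G * H)%type) ^+ n = (x ^+ n, y ^+ n).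
Proof. by elim: n => // n IHn; rewrite !expgS IHn. Qed.

Lemma pairR (G H : finGroupType) (x x' : G) (y y' : H) :
  [~ ((x, y) : (G * H)%type), (x', y')] = ([~ x, x'], [~ y, y']).
Proof. by []. Qed.

(* The subgroup of G x E generated by (a, x) and (b, y) satisfies the
   relations, so it is no larger than G and is the graph of a morphism. *)
Lemma presented_universal (G : finGroupType) : presented G ->
  exists a b : G, [/\ <<[set a; b]>> = [set: G], relations a b
    & universal_pair a b].
Proof.
move=> presG; have /presG[a [b [genG rel_ab]]] := homg_refl [set: G].
exists a, b; split=> // E x y rel_xy.
pose X : (G * E)%type := (a, x); pose Y : (G * E)%type := (b, y).
pose D := <<[set X; Y]>>%G.
have homD : D \homg [set: G].
  apply/presG; exists X, Y; split=> //.
  case: rel_ab => a1 a2 a3 a4 a5; case: rel_xy => x1 x2 x3 x4 x5.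
  by split; rewrite !(pairX, pairR) ?a1 ?a2 ?a3 ?a4 ?a5 ?x1 ?x2 ?x3 ?x4 ?x5.
pose pr1 := [morphism of (@fst G E)].
have imD : pr1 @* D = [set: G].
  by rewrite morphim_gen ?subsetT // morphimU !morphim_set1 ?inE.
have eimD : (@fst G E) @: D = [set: G] by rewrite -imD morphimEsub ?subsetT.
have injD : {in D &, injective (@fst G E)}.
  apply/imset_injP; rewrite eqn_leq leq_imset_card eimD.
  exact: leq_homg homD.
have /(_ _)/cid2 -/all_sig2[s sD s1] g : exists2 d, d \in D & d.1 = g.
  have : g \in (@fst G E) @: D by rewrite eimD inE.
  by case/imsetP=> d dD ->; exists d.
pose f g := (s g).2.
have fM : {morph f : g h / g * h}.
  move=> g h; rewrite /f (injD (s (g * h)) (s g * s h)) ?groupM //.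
  by rewrite s1 /= !s1.
have sE d : d \in D -> s d.1 = d by move=> dD; apply: injD.
have XD : X \in D by rewrite mem_gen ?set21.
have YD : Y \in D by rewrite mem_gen ?set22.
pose f' : {multiplicative G -> E} := HB.pack f (isMultiplicative.Build _ _ f fM).
by exists f'; rewrite /= /f (sE X) // (sE Y).
Qed.
End Presentations.

(** * Quotient maps and lifting from a free group *)

Section QuotientMap.

Variables (F : groupType) (B : F -> Prop) (nB : normal_in fullG B).

Definition quot_map (x : F) : quot nB :=
  Quot nB (ex_intro2 _ (fun y => lcoset_pred B x = lcoset_pred B y) x I erefl).

Lemma quot_mapM : {morph quot_map : x y / x * y}.
Proof. by move=> x y; apply: quot_inj; rewrite /= (lcoset_predM nB). Qed.

HB.instance Definition _ :=
  isMultiplicative.Build F (quot nB) quot_map quot_mapM.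

Lemma quot_map_surj (C : quot nB) : exists x, quot_map x = C.
Proof.
by have [x _ xC] := quot_setP C; exists x; apply: quot_inj; rewrite xC.
Qed.

Lemma quot_map_eq1 x : quot_map x = 1 <-> B x.
Proof.
have [_ sB _ _] := nB; split=> [/(congr1 (fun C => quot_set C x)) /= | Bx].
  by rewrite /lcoset_pred mulVg invg1 mul1g => <-; apply: subgroup1.
apply: quot_inj => /=; apply/funext=> y; apply/propext; rewrite /lcoset_pred.
rewrite invg1 mul1g; split=> [By | By]; last first.
  by apply: (subgroupM sB) => //; apply: (subgroupV sB).
by rewrite -[y](mulKVg x); apply: (subgroupM sB).
Qed.

End QuotientMap.

Lemma isomorphic_projection (G F : groupType) (R : F -> Prop)
    (nR : normal_in fullG R) : isomorphic G (quot nR) ->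
  exists pi : {multiplicative F -> G},
    (forall g, exists x, pi x = g) /\ (forall x, pi x = 1 <-> R x).
Proof.
case=> f [f' fK f'K]; pose pi x := f' (quot_map nR x).
have piM : {morph pi : x y / x * y}.
  by move=> x y; rewrite /pi gmulfM (can2_gmulfM fK f'K).
pose pi' : {multiplicative F -> G} :=
  HB.pack pi (isMultiplicative.Build _ _ pi piM).
exists pi'; split=> [g | x].
  by have [x xg] := quot_map_surj (f g); exists x; rewrite /= /pi xg fK.
rewrite -(quot_map_eq1 nR) /= /pi; split=> [|->].
  by move/(congr1 f); rewrite f'K multiplicative1.
by rewrite -(multiplicative1 f) fK.
Qed.

Lemma commRFF_kernel (F E : groupType) (R : F -> Prop)
    (phi : {multiplicative F -> E}) :
    (forall r, R r -> second_center (phi r)) ->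
  forall x, commRFF R x -> phi x = 1.
Proof.
move=> phiR x xRFF; apply: (xRFF (fun x => phi x = 1)).
  split=> [|y z py pz]; first exact: multiplicative1.
  by rewrite gmulfM multiplicativeV py pz mul1g invg1.
move=> _ [y [z [yRF _ ->]]]; rewrite multiplicativeR; apply/eqP/commgP.
move: (phi z); apply: (yRF (fun y => group_center (phi y))).
  have [_ [Z1 ZF] _ _] := group_center_normal E.
  split=> [|u v uZ vZ]; first by rewrite multiplicative1.
  by rewrite gmulfM multiplicativeV; apply: ZF.
move=> _ [r [g [Rr _ ->]]]; rewrite multiplicativeR.
exact/second_center_comm/phiR.
Qed.

Section Lifting.

Variables (G : finGroupType) (F : groupType) (R : F -> Prop).
Variable pi : {multiplicative F -> G}.
Hypotheses (freeF : free_group F) (piR : forall x, pi x = 1 <-> R x).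

(** Free groups are projective: basis elements are sent into the fibres of [q], and the uniqueness
    clause of freeness identifies the two composites. *)
Lemma free_lift (E L : groupType) (q : {multiplicative E -> L})
    (h : {multiplicative G -> L}) : (forall y, exists x, q x = y) ->
  exists phi : {multiplicative F -> E}, forall x, q (phi x) = h (pi x).
Proof.
move=> qsurj; have [X [iota univ]] := freeF.
have /choice[s sE] x : exists e, q e = h (pi (iota x)) by apply: qsurj.
have [phi phiE _] := univ E s; exists phi => x.
have [psi _ psiU] := univ L (h \o pi \o iota).
have -> : q (phi x) = psi x.
  apply: (psiU (q \o phi : {multiplicative F -> L})) => y /=.
  by rewrite -sE; congr (q _); apply: phiE.
by rewrite -(psiU (h \o pi : {multiplicative F -> L})).
Qed.

Variables (nal nbe nga nsi : nat) (a b : F).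
Hypothesis univ : universal_pair nal nbe nga nsi (pi a) (pi b).

(** Modulo the second center x and y satisfy the relations of G, so G maps to the finite group
    E/Z_2(E). Freeness lifts the composite with [pi] to E, and R, killed by [pi], lands in
    Z_2(E). *)
Lemma lift_mod_second_center (E : finGroupType) (x y : E) :
    second_center (x ^+ nal) -> second_center ([~ x, y] ^+ nga) ->
    second_center [~ x, y, x] -> second_center [~ x, y, y] ->
    second_center (y ^+ nbe * [~ x, y] ^- nsi) ->
  exists phi : {multiplicative F -> E},
    [/\ forall r, R r -> second_center (phi r),
        exists2 z, second_center z & phi a = x * z
      & exists2 z, second_center z & phi b = y * z].
Proof.
move=> x2 c2 u2 w2 y2; pose Z := 'Z_2([set: E]).
have nZ e : e \in 'N(Z) by apply: (subsetP (ucn_norm 2 [set: E])); rewrite inE.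
have qM : {morph coset Z : e e' / e * e'} by move=> e e'; apply: coset_morphM.
pose q : {multiplicative E -> coset_of Z} :=
  HB.pack (coset Z) (isMultiplicative.Build _ _ (coset Z) qM).
have q1 e : second_center e <-> q e = 1.
  by rewrite -ucn2_second_center; split=> [/coset_id | /(coset_idr (nZ e))].
have qE e e' : q e = q e' -> exists2 z, second_center z & e = e' * z.
  move=> qee'; exists (e'^-1 * e); last by rewrite mulVKg.
  by apply/q1; rewrite gmulfM multiplicativeV qee' mulVg.
have [h [ha hb]] : exists h : {multiplicative G -> coset_of Z},
    h (pi a) = q x /\ h (pi b) = q y.
  apply: univ; split.
  - by rewrite -multiplicativeX; apply/q1.
  - by rewrite -multiplicativeR -multiplicativeX; apply/q1.
  - by rewrite -!multiplicativeR; apply/q1.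
  - by rewrite -!multiplicativeR; apply/q1.
  - rewrite -multiplicativeR -!multiplicativeX; apply: divg1_eq.
    by rewrite -multiplicativeV -gmulfM; apply/q1.
have qsurj C : exists e, q e = C.
  by have [e _ ->] := cosetP C; exists e.
have [phi phiE] := free_lift h qsurj.
exists phi; split=> [r /piR r1 | |].
- by apply/q1; rewrite phiE r1 multiplicative1.
- by apply: qE; rewrite phiE.
- by apply: qE; rewrite phiE.
Qed.

End Lifting.

(** [second_center] quantifies over a whole type, so the subgroup generated by x and y is made into
    a type. *)
Lemma generated_subg (gT : finGroupType) (x y : gT) :
  exists (E : finGroupType) (val : {multiplicative E -> gT}) (x' y' : E),
    [/\ injective val, val x' = x, val y' = y & <<[set x'; y']>>%g = [set: E]].
Proof.
pose D := <<[set x; y]>>%G.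
have valM : {morph (@sgval _ D) : u w / (u * w)%g} by [].
pose val' : {multiplicative subg_of D -> gT} :=
  HB.pack (@sgval _ D) (isMultiplicative.Build _ _ (@sgval _ D) valM).
have xD : x \in D by rewrite mem_gen ?set21.
have yD : y \in D by rewrite mem_gen ?set22.
exists (subg_of D), val', (subg D x), (subg D y).
split; [exact: subg_inj | exact: subgK | exact: subgK |].
apply: (@injm_morphim_inj _ _ _ (sgval_morphism D)) => //; rewrite ?subsetT //.
  exact: injm_sgval.
rewrite morphim_gen ?subsetT // morphimU !morphim_set1 ?inE //= !subgK //.
by rewrite im_sgval.
Qed.

Lemma second_center_val (E gT : finGroupType) (val : {multiplicative E -> gT})
    (x y z : E) : injective val -> <<[set x; y]>>%g = [set: E] ->
    [~ val z, val x, val x]%g = 1%g -> [~ val z, val x, val y]%g = 1%g ->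
    [~ val z, val y, val x]%g = 1%g -> [~ val z, val y, val y]%g = 1%g ->
  second_center z.
Proof.
move=> val_inj genE zxx zxy zyx zyy.
have val1 u : val u = 1%g -> u = 1%g.
  by rewrite -(multiplicative1 val) => /val_inj.
apply: (@second_center_gen _ x y) => [P sP Px Py||||];
  do 1?[by apply: val1; rewrite !multiplicativeR].
by apply: (gen_ind genE sP) => u /set2P[] ->.
Qed.

(** * Test groups generated by two affine permutations *)

Section AffineModel.

Local Open Scope ring_scope.

Variables (S : finComNzRingType) (N : S).
Hypothesis N4 : N ^+ 4 = 0.

Definition affine (d e : S) (z : S) : S := z * (1 + d * N) + e.

Lemma affine_inj d e : injective (affine d e).
Proof.
move=> z z' /addIr zz'.
(* The truncated geometric series inverts [1 + d * N], as [N ^+ 4 = 0]. *)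
pose r := 1 - d * N + d ^+ 2 * N ^+ 2 - d ^+ 3 * N ^+ 3.
have unitK (s : S) : s = s * (1 + d * N) * r.
  have -> : s * (1 + d * N) * r = s - s * d ^+ 4 * N ^+ 4 by rewrite /r; ring.
  by rewrite N4 mulr0 subr0.
by rewrite (unitK z) zz' -unitK.
Qed.

Definition affine_perm d e : {perm S} := perm (@affine_inj d e).

Lemma affine_permE d e z : affine_perm d e z = z * (1 + d * N) + e.
Proof. by rewrite permE. Qed.

Definition transl (e : S) : {perm S} := affine_perm 0 e.

Lemma translE e z : transl e z = z + e.
Proof. by rewrite affine_permE mul0r addr0 mulr1. Qed.

Lemma transl_mul e f : (transl e * transl f)%g = transl (e + f).
Proof. by apply/permP=> z; rewrite permM !translE addrA. Qed.

Lemma transl0 : transl 0 = 1%g.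
Proof. by apply/permP=> z; rewrite perm1 translE addr0. Qed.

Lemma transl_exp e n : (transl e ^+ n)%g = transl (e *+ n).
Proof.
elim: n => [|n IHn]; first by rewrite transl0.
by rewrite expgS IHn transl_mul -mulrS.
Qed.

Lemma translV e : (transl e)^-1%g = transl (- e).
Proof. by apply: mulg1_eq; rewrite transl_mul subrr transl0. Qed.

Lemma transl_eq1 e : transl e = 1%g -> e = 0.
Proof. by move/permP/(_ 0); rewrite perm1 translE add0r. Qed.

Lemma commg_eq (s t r : {perm S}) : (s * t = t * s * r)%g -> [~ s, t]%g = r.
Proof. by rewrite commgC => /mulgI. Qed.

Lemma comm_transl e d f : [~ transl e, affine_perm d f]%g = transl (e * d * N).
Proof.
by apply/commg_eq/permP=> z; rewrite !permM !(translE, affine_permE); ring.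
Qed.

Lemma comm_transl_transl e f : [~ transl e, transl f]%g = 1%g.
Proof. by rewrite comm_transl mulr0 mul0r transl0. Qed.

(** The sum of (1 + d N)^i over i < n, by Horner's rule. *)
Fixpoint geom (d : S) (n : nat) : S :=
  if n is n'.+1 then geom d n' * (1 + d * N) + 1 else 0.

Lemma affine_perm_exp d e n z :
  (affine_perm d e ^+ n)%g z = z * (1 + d * N * geom d n) + e * geom d n.
Proof.
elim: n => [|n IHn] /=; first by rewrite expg0 perm1; ring.
by rewrite expgSr permM IHn affine_permE; ring.
Qed.

(** Against N^2 only the terms 1 + i d N of (1 + d N)^i survive. *)
Lemma geom_sqr d n : geom d n * N ^+ 2 = N ^+ 2 *+ n + d * N ^+ 3 *+ 'C(n, 2).
Proof.
elim: n => [|n IHn] /=; first by rewrite mul0r addr0.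
rewrite mulrDl mulrAC IHn mulrDl !mulrDr !mulr1 binS bin1.
rewrite [_ *+ 'C(n, 2) * _]mulrC mulrnAr.
have -> : d * N * (d * N ^+ 3) = 0.
  by rewrite -[RHS](mulr0 (d ^+ 2)) -N4; ring.
rewrite mul0rn; have -> : N ^+ 2 *+ n * (d * N) = d * N ^+ 3 *+ n.
  by rewrite mulrnAl; congr (_ *+ _); ring.
rewrite mul1r mulrSr mulrnDr; ring.
Qed.

Variables (d e v w : S).
Let x := affine_perm d v.
Let y := affine_perm e w.
Let k := v * e - w * d.

Lemma comm_affine : [~ x, y]%g = transl (k * N).
Proof.
by apply/commg_eq/permP=> z; rewrite !permM !(translE, affine_permE) /k; ring.
Qed.

Lemma comm_affine_exp_left n : [~ x ^+ n, y]%g = transl (k * geom d n * N).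
Proof.
apply/commg_eq/permP=> z.
by rewrite !permM !(translE, affine_permE, affine_perm_exp) /k; ring.
Qed.

Lemma comm_affine_exp_right n : [~ y ^+ n, x]%g = transl (- (k * geom e n * N)).
Proof.
apply/commg_eq/permP=> z.
by rewrite !permM !(translE, affine_permE, affine_perm_exp) /k; ring.
Qed.

(** The commutator [x,y] is translation by k N; each further commutator with x or y multiplies the
    translation by d N or e N. *)
Lemma gamma3_word_affine P i j h l m :
  gamma3_word P i j h l m x y = transl (k *
    ((d *+ i + e *+ j + d *+ P *+ h) * N ^+ 2 +
     (d ^+ 2 *+ h + (d * e) *+ l + e ^+ 2 *+ m) * N ^+ 3)).
Proof.
rewrite /gamma3_word !(comm_affine, comm_transl) !(transl_exp, transl_mul).
by congr transl; ring.
Qed.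

Variables (nal nbe nga nsi : nat).
Hypotheses (bin_al : (nal %| 'C(nal, 2))%N) (bin_be : (nsi %| 'C(nbe, 2))%N).
Hypotheses (N_al : N ^+ 2 *+ nal = 0) (N_ga : N ^+ 3 *+ nga = 0).
Hypothesis N_be : N ^+ 2 *+ nbe + d * N ^+ 3 *+ nsi = 0.
Hypothesis N_si : e * N ^+ 3 *+ nsi = 0.

(** A translation by f is in the second center of the group generated by x and y once f N^2 = 0; any
    element is, once its commutators with x and y are translations killed by N. The hypotheses on N
    ensure this for the relators. *)
Lemma affine_model : exists (E : finGroupType) (a b : E),
  [/\ second_center (a ^+ nal)%g, second_center ([~ a, b] ^+ nga)%g,
      second_center [~ a, b, a]%g /\ second_center [~ a, b, b]%g,
      second_center (b ^+ nbe * [~ a, b] ^- nsi)%g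
    & forall P i j h l m, gamma3_word P i j h l m a b = 1%g ->
      k * ((d *+ i + e *+ j + d *+ P *+ h) * N ^+ 2 +
        (d ^+ 2 *+ h + (d * e) *+ l + e ^+ 2 *+ m) * N ^+ 3) = 0].
Proof.
have [E [val [a [b [val_inj val_a val_b genE]]]]] := generated_subg x y.
have Z2 z (s := val z) : [~ s, x, x]%g = 1%g -> [~ s, x, y]%g = 1%g ->
    [~ s, y, x]%g = 1%g -> [~ s, y, y]%g = 1%g -> second_center z.
  by rewrite /s -val_a -val_b; apply: second_center_val.
have Z2t z f : val z = transl f -> f * N ^+ 2 = 0 -> second_center z.
  move=> zf fN; have fN' (s t : S) : f * s * N * t * N = 0.
    by rewrite -[RHS](mulr0 (s * t)) -fN; ring.
  by apply: Z2; rewrite zf !comm_transl fN' transl0.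
have valE :=
  (multiplicativeX val, multiplicativeR val, multiplicativeV val,
   @gmulfM _ _ val).
have binN n q f : (n %| q)%N -> f *+ n = 0 -> f *+ q = 0 :> S.
  by move=> /dvdnP[r ->] fn; rewrite mulnC mulrnA fn mul0rn.
have N3_al : d * N ^+ 3 *+ nal = 0.
  by rewrite -[RHS](mulr0 (d * N)) -N_al; ring.
have geom_al : geom d nal * N ^+ 2 = 0.
  by rewrite geom_sqr N_al add0r (binN _ _ _ bin_al).
have geom_be : geom e nbe * N ^+ 2 = N ^+ 2 *+ nbe.
  by rewrite geom_sqr (binN _ _ _ bin_be) ?addr0.
exists E, a, b; split.
- have xy0 (s : S) : k * geom d nal * N * s * N = 0.
    by rewrite -[RHS](mulr0 (k * s)) -geom_al; ring.
  have xx : [~ x ^+ nal, x]%g = 1%g.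
    by apply/eqP/commgP/commute_sym/commuteX.
  by apply: Z2; rewrite valE val_a ?xx ?comm1g // comm_affine_exp_left
    comm_transl xy0 transl0.
- apply: (Z2t _ (k * N *+ nga)).
    by rewrite !valE val_a val_b comm_affine transl_exp.
  by rewrite -[RHS](mulr0 k) -N_ga; ring.
- split.
    apply: (Z2t _ (k * N * d * N)).
      by rewrite !valE val_a val_b comm_affine comm_transl.
    by rewrite -[RHS](mulr0 (k * d)) -N4; ring.
  apply: (Z2t _ (k * N * e * N)).
    by rewrite !valE val_a val_b comm_affine comm_transl.
  by rewrite -[RHS](mulr0 (k * e)) -N4; ring.
- have tau : val (b ^+ nbe * [~ a, b] ^- nsi)%g =
      (y ^+ nbe * transl (- (k * N *+ nsi)))%g.
    by rewrite !valE val_a val_b comm_affine transl_exp translV.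
  have cx : [~ y ^+ nbe * transl (- (k * N *+ nsi)), x]%g =
      transl (- (k * geom e nbe * N) - k * N *+ nsi * d * N).
    rewrite commMg_conj comm_affine_exp_right comm_transl.
    rewrite conjg_id ?transl_mul; last first.
      by apply/commgP; rewrite comm_transl_transl.
    by congr transl; ring.
  have cy : [~ y ^+ nbe * transl (- (k * N *+ nsi)), y]%g =
      transl (- (k * (e * N ^+ 2 *+ nsi))).
    rewrite commMg_conj comm_transl.
    have /commgP/eqP -> : commute (y ^+ nbe)%g y by apply/commute_sym/commuteX.
    by rewrite conj1g mul1g; congr transl; ring.
  have cxN (s : S) :
      (- (k * geom e nbe * N) - k * N *+ nsi * d * N) * s * N = 0.
    rewrite -[RHS](mulr0 (- k * s)) -N_be -geom_be; ring.
  have cyN (s : S) : - (k * (e * N ^+ 2 *+ nsi)) * s * N = 0.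
    rewrite -[RHS](mulr0 (- k * s)) -N_si; ring.
  by apply: Z2; rewrite tau ?cx ?cy comm_transl ?cxN ?cyN transl0.
move=> P i j h l m word1; apply: transl_eq1.
rewrite -gamma3_word_affine -[x]val_a -[y]val_b -gmulf_gamma3_word word1.
exact: multiplicative1.
Qed.

End AffineModel.

(* Commutative A-algebra with basis 1, N, N^2, g in which                    *)
(* N^3 = t d (d g - N^2), N g = t (d g - N^2) and N^2 g = g^2 = 0; thus       *)
(* N^4 = 0. With t = p^(beta-gamma), d = p^(gamma-sigma) over Z/p^alpha,      *)
(* N^2 and N^3 satisfy exactly the relations between -u and -[u,a].           *)
Definition shift_ring (A : finComNzRingType) (t d : A) : Type :=
  (A * A * A * A)%type.

(** * The coefficient ring, and the relations between N^2 and N^3 *)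

Section ShiftRing.

Local Open Scope ring_scope.

Variables (A : finComNzRingType) (t d : A).
Local Notation shift_ring := (shift_ring t d).

HB.instance Definition _ := Finite.on shift_ring.
HB.instance Definition _ := GRing.Zmodule.on shift_ring.

Definition shift_one : shift_ring := (1, 0, 0, 0).

Definition shift_mul (x y : shift_ring) : shift_ring :=
  let: (x0, x1, x2, x3) := x in let: (y0, y1, y2, y3) := y in
  let s := d * (x1 * y2 + x2 * y1) + (x1 * y3 + x3 * y1) in
  (x0 * y0, x0 * y1 + x1 * y0, x0 * y2 + x2 * y0 + x1 * y1 - t * s,
   x0 * y3 + x3 * y0 + t * d * s).

Lemma shift_mulA : associative shift_mul.
Proof.
move=> [[[x0 x1] x2] x3] [[[y0 y1] y2] y3] [[[z0 z1] z2] z3] /=.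
by congr (_, _, _, _); ring.
Qed.

Lemma shift_mulC : commutative shift_mul.
Proof.
move=> [[[x0 x1] x2] x3] [[[y0 y1] y2] y3] /=.
by congr (_, _, _, _); ring.
Qed.

Lemma shift_mul1 : left_id shift_one shift_mul.
Proof. by move=> [[[y0 y1] y2] y3] /=; congr (_, _, _, _); ring. Qed.

Lemma shift_mulDl : left_distributive shift_mul +%R.
Proof.
move=> [[[x0 x1] x2] x3] [[[y0 y1] y2] y3] [[[z0 z1] z2] z3].
by rewrite /GRing.add /=; congr (_, _, _, _); rewrite /=; ring.
Qed.

Lemma shift_one_neq0 : shift_one != 0.
Proof. by apply/eqP => -[] /eqP; rewrite oner_eq0. Qed.

HB.instance Definition _ := GRing.Zmodule_isComNzRing.Build shift_ring
  shift_mulA shift_mulC shift_mul1 shift_mulDl shift_one_neq0.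

Lemma shift_mulE (x y : shift_ring) : x * y = shift_mul x y.
Proof. by []. Qed.

Lemma shift_addE (x0 x1 x2 x3 y0 y1 y2 y3 : A) :
  ((x0, x1, x2, x3) : shift_ring) + (y0, y1, y2, y3) =
  (x0 + y0, x1 + y1, x2 + y2, x3 + y3).
Proof. by []. Qed.

Definition shift_gen : shift_ring := (0, 1, 0, 0).

Lemma shift_natmul (x0 x1 x2 x3 : A) n :
  ((x0, x1, x2, x3) : shift_ring) *+ n = (x0 *+ n, x1 *+ n, x2 *+ n, x3 *+ n).
Proof. by elim: n => // n IHn; rewrite !mulrS IHn. Qed.

Lemma shift_gen2 : shift_gen ^+ 2 = (0, 0, 1, 0).
Proof.
by rewrite expr2 shift_mulE; congr (_, _, _, _); ring.
Qed.

Lemma shift_gen3 : shift_gen ^+ 3 = (0, 0, - (t * d), t * d ^+ 2).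
Proof.
by rewrite exprS shift_gen2 shift_mulE; congr (_, _, _, _); ring.
Qed.

Lemma shift_gen4 : shift_gen ^+ 4 = 0.
Proof.
by rewrite exprS shift_gen3 shift_mulE; congr (_, _, _, _); ring.
Qed.

Lemma shift_gen23 m n : shift_gen ^+ 2 *+ m + shift_gen ^+ 3 *+ n =
  (0, 0, m%:R - t * d * n%:R, t * d ^+ 2 * n%:R).
Proof.
rewrite shift_gen2 shift_gen3 !shift_natmul shift_addE.
by congr (_, _, _, _); ring.
Qed.

End ShiftRing.

Section ZpDivisibility.

Local Open Scope ring_scope.


Lemma natr_Zp_eq0 q n : (1 < q)%N -> (n%:R : 'Z_q) = 0 -> (q %| n)%N.
Proof. by move=> q1 /(congr1 val) /=; rewrite val_Zp_nat // => /eqP. Qed.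

Lemma Zp_natr_eq0 q n : (1 < q)%N -> (q %| n)%N -> (n%:R : 'Z_q) = 0.
Proof. by move=> q1 /dvdnP[m ->]; rewrite natrM pchar_Zp // mulr0. Qed.

Lemma dvdn_bin2 q : odd q -> (q %| 'C(q, 2))%N.
Proof.
move=> q_odd; rewrite bin2 -divn2 -muln_divA ?dvdn_mulr // dvdn2.
by rewrite -subn1 oddB ?odd_gt0 // q_odd.
Qed.
End ZpDivisibility.

Section ShiftRelations.

Local Open Scope ring_scope.

Variables (q T D : nat).
Hypothesis q_gt1 : (1 < q)%N.
Let N : shift_ring (T%:R : 'Z_q) (D%:R : 'Z_q) := shift_gen _ _.

Lemma shift_rel0 m n : (q %| m)%N -> (q %| T * D * n)%N ->
  N ^+ 2 *+ m = 0 /\ N ^+ 3 *+ n = 0.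
Proof.
move=> qm qn; have qn' : (q %| T * D ^ 2 * n)%N.
  by rewrite expnS expn1 mulnA -mulnA mulnCA dvdn_mull.
have := shift_gen23 (T%:R : 'Z_q) D%:R m 0.
have := shift_gen23 (T%:R : 'Z_q) D%:R 0 n.
rewrite !mulr0n add0r addr0 => -> ->; rewrite -natrX -!natrM.
rewrite !mulr0 !subr0 (Zp_natr_eq0 _ qm) // (Zp_natr_eq0 _ qn) //.
by rewrite (Zp_natr_eq0 _ qn') //; split=> //; congr (_, _, _, _); apply: subr0.
Qed.

Lemma shift_rel m n : (q %| T * D ^ 2 * n)%N -> m = (T * D * n)%N ->
  N ^+ 2 *+ m + N ^+ 3 *+ n = 0.
Proof.
move=> qn ->; rewrite shift_gen23 -natrX -!natrM subrr.
by rewrite (Zp_natr_eq0 _ qn).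
Qed.

(** The coordinates at N^2 and g are m - T D n and T D^2 n; [m'] replaces the subtraction. *)
Lemma shift_relP m n : N ^+ 2 *+ m + N ^+ 3 *+ n = 0 ->
  (q %| T * D ^ 2 * n)%N /\ forall m', m = (m' + T * D * n)%N -> (q %| m')%N.
Proof.
rewrite shift_gen23 -natrX -!natrM => mn0.
have m0 : m%:R - (T * D * n)%:R = 0 :> 'Z_q := congr1 (fun z => z.1.2) mn0.
split=> [|m' mE]; apply: (natr_Zp_eq0 q_gt1).
  exact: (congr1 (fun z => z.2) mn0).
by rewrite -m0 mE natrD addrK.
Qed.

End ShiftRelations.

(** * Four test groups detecting the exponents *)

Section Models.

Local Open Scope ring_scope.

Variables (p al be ga si : nat).
Hypotheses (p_odd : odd p) (p_gt1 : (1 < p)%N).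
Hypotheses (si_ga : (si <= ga)%N) (ga_be : (ga <= be)%N).
Hypotheses (albe : (al + si = be + ga)%N) (ga_gt0 : (0 < ga)%N).

Definition weak_relations (E : groupType) (x y : E) :=
  [/\ second_center (x ^+ (p ^ al)%N)%g,
      second_center ([~ x, y] ^+ (p ^ ga)%N)%g,
      second_center [~ x, y, x]%g /\ second_center [~ x, y, y]%g
    & second_center (y ^+ (p ^ be)%N * [~ x, y] ^- (p ^ si)%N)%g].

(** One test group imposes the condition on every word trivial in it; by lifting, every word lying
    in [R,F,F] then satisfies it. *)
Definition detects (P : nat -> nat -> nat -> nat -> nat -> Prop) :=
  exists (E : finGroupType) (x y : E), weak_relations x y /\
    forall i j h l m,
      gamma3_word (p ^ (be - si)) i j h l m x y = 1%g -> P i j h l m.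

Let pX_odd n : odd (p ^ n).
Proof. by rewrite oddX p_odd orbT. Qed.

Let pX_gt1 n : (0 < n)%N -> (1 < p ^ n)%N.
Proof. by move=> n0; rewrite -(exp1n n) ltn_exp2r. Qed.

Let ga_al : (ga <= al)%N. Proof. lia. Qed.
Let be_al : (be <= al)%N. Proof. lia. Qed.
Let si_al : (si <= al)%N. Proof. lia. Qed.
Let si_be : (si <= be)%N. Proof. lia. Qed.

Let si_bin : (p ^ si %| 'C(p ^ be, 2))%N.
Proof.
apply: dvdn_trans (dvdn_bin2 (pX_odd be)).
by rewrite dvdn_exp2l // (leq_trans si_ga).
Qed.

(** For x: z |-> z (1 + N) and y: z |-> z + 1 the word is translation by -((i + P h) N^2 + h N^3).
    As T D = P and T D^2 = p^(al-si), its vanishing gives both divisibilities. *)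
Lemma model_u_t1 : detects (fun i j h l m =>
  (p ^ al %| i)%N /\ (p ^ si %| h)%N).
Proof.
have al_gt1 : (1 < p ^ al)%N by apply: pX_gt1; lia.
pose T := (p ^ (be - ga))%N; pose D := (p ^ (ga - si))%N.
have TD n : (T * D * p ^ n = p ^ (be - si + n))%N.
  by rewrite -!expnD; congr (_ ^ _)%N; lia.
have TD2 n : (T * D ^ 2 * p ^ n = p ^ (al - si + n))%N.
  by rewrite -expnM -!expnD; congr (_ ^ _)%N; lia.
pose N := shift_gen (T%:R : 'Z_(p ^ al)) D%:R.
have [N_al N_ga] : N ^+ 2 *+ (p ^ al) = 0 /\ N ^+ 3 *+ (p ^ ga) = 0.
  by apply: shift_rel0; rewrite // TD dvdn_exp2l //; lia.
have N_be : N ^+ 2 *+ (p ^ be) + 1 * N ^+ 3 *+ (p ^ si) = 0.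
  rewrite mul1r; apply: shift_rel => //; first by rewrite TD2 dvdn_exp2l //; lia.
  by rewrite TD; congr (_ ^ _)%N; lia.
have N_si : 0 * N ^+ 3 *+ (p ^ si) = 0 by rewrite mul0r mul0rn.
have [E [x [y [x2 c2 u2 y2 word]]]] :=
  @affine_model _ N (shift_gen4 _ _) 1 0 0 1
  _ _ _ _ (dvdn_bin2 (pX_odd al)) si_bin N_al N_ga N_be N_si.
exists E, x, y; split=> [|i j h l m /word]; first by split.
have -> : (p ^ (be - si) = T * D)%N.
  by have := TD 0%N; rewrite expn0 muln1 addn0.
move=> w0; have /shift_relP[] // : N ^+ 2 *+ (i + T * D * h) + N ^+ 3 *+ h = 0.
  by rewrite -[LHS]opprK -[RHS]oppr0 -w0; congr (- _); ring.
move=> qh /(_ i erefl) qi; split=> //; move: qh.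
have := TD2 0%N; rewrite expn0 muln1 addn0 => ->.
rewrite -(subnK (leq_trans si_ga ga_al)) expnD addnK dvdn_pmul2l //.
by rewrite expn_gt0; lia.
Qed.

(** With T = 0 one has N^3 = 0, while N^2 has additive order p^be. *)
Lemma model_w : detects (fun i j h l m => (p ^ be %| j)%N).
Proof.
have be_gt1 : (1 < p ^ be)%N by apply: pX_gt1; lia.
pose N := shift_gen (0%:R : 'Z_(p ^ be)) 1%:R.
have N_rel m n : (p ^ be %| m)%N -> N ^+ 2 *+ m = 0 /\ N ^+ 3 *+ n = 0.
  by move=> qm; apply: shift_rel0.
have [N_al N_ga] := N_rel (p ^ al)%N (p ^ ga)%N (dvdn_exp2l p be_al).
have [N_be' N_si'] := N_rel (p ^ be)%N (p ^ si)%N (dvdnn _).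
have N_be : N ^+ 2 *+ (p ^ be) + 0 * N ^+ 3 *+ (p ^ si) = 0.
  by rewrite N_be' mul0r mul0rn addr0.
have N_si : 1 * N ^+ 3 *+ (p ^ si) = 0 by rewrite mul1r.
have [E [x [y [x2 c2 u2 y2 word]]]] :=
  @affine_model _ N (shift_gen4 _ _) 0 1 1 0
  _ _ _ _ (dvdn_bin2 (pX_odd al)) si_bin N_al N_ga N_be N_si.
exists E, x, y; split=> [|i j h l m /word w0]; first by split.
have /shift_relP[] // : N ^+ 2 *+ j + N ^+ 3 *+ m = 0 by rewrite -w0; ring.
by move=> _; apply; rewrite mul0n addn0.
Qed.

(** With T = D = 1, N^2 and N^3 are independent of order p^si. As x is a translation, only the
    exponents j and m are seen. *)
Lemma model_t3 : detects (fun i j h l m => (p ^ si %| m)%N).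
Proof.
(* ['Z_1] has two elements, so [si = 0] is separate; divisibility by 1 is vacuous and any test group
   will do. *)
have [si0|si_gt0] := posnP si.
  have [E [x [y [rel_xy _]]]] := model_w; exists E, x, y; split=> // *.
  by rewrite si0 expn0 dvd1n.
have q_gt1 := pX_gt1 si_gt0.
pose N := shift_gen (1%:R : 'Z_(p ^ si)) 1%:R.
have N_rel m n : (si <= m)%N -> (si <= n)%N ->
    N ^+ 2 *+ (p ^ m) = 0 /\ N ^+ 3 *+ (p ^ n) = 0.
  by move=> qm qn; apply: shift_rel0; rewrite // ?mul1n dvdn_exp2l.
have [N_al N_ga] := N_rel al ga si_al si_ga.
have [N_be' N_si'] := N_rel be si si_be (leqnn _).
have N_be : N ^+ 2 *+ (p ^ be) + 0 * N ^+ 3 *+ (p ^ si) = 0.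
  by rewrite N_be' mul0r mul0rn addr0.
have N_si : 1 * N ^+ 3 *+ (p ^ si) = 0 by rewrite mul1r.
have [E [x [y [x2 c2 u2 y2 word]]]] :=
  @affine_model _ N (shift_gen4 _ _) 0 1 1 0
  _ _ _ _ (dvdn_bin2 (pX_odd al)) si_bin N_al N_ga N_be N_si.
exists E, x, y; split=> [|i j h l m /word w0]; first by split.
have /shift_relP[] // : N ^+ 2 *+ j + N ^+ 3 *+ m = 0 by rewrite -w0; ring.
by rewrite !mul1n.
Qed.

(** With d = e = 1 the commutators [u,a], [u,b], [w,b] are the same translation, so the N^3 part
    sees the sum of their exponents. *)
Lemma model_t2 : detects (fun i j h l m => (p ^ si %| h + l + m)%N).
Proof.
have [si0|si_gt0] := posnP si.
  have [E [x [y [rel_xy _]]]] := model_w; exists E, x, y; split=> // *.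
  by rewrite si0 expn0 dvd1n.
have q_gt1 := pX_gt1 si_gt0.
pose N := shift_gen (1%:R : 'Z_(p ^ si)) 1%:R.
have N_rel m n : (si <= m)%N -> (si <= n)%N ->
    N ^+ 2 *+ (p ^ m) = 0 /\ N ^+ 3 *+ (p ^ n) = 0.
  by move=> qm qn; apply: shift_rel0; rewrite // ?mul1n dvdn_exp2l.
have [N_al N_ga] := N_rel al ga si_al si_ga.
have [N_be' N_si'] := N_rel be si si_be (leqnn _).
have N_be : N ^+ 2 *+ (p ^ be) + 1 * N ^+ 3 *+ (p ^ si) = 0.
  by rewrite N_be' mul1r add0r.
have N_si : 1 * N ^+ 3 *+ (p ^ si) = 0 by rewrite mul1r.
have [E [x [y [x2 c2 u2 y2 word]]]] :=
  @affine_model _ N (shift_gen4 _ _) 1 1 0 1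
  _ _ _ _ (dvdn_bin2 (pX_odd al)) si_bin N_al N_ga N_be N_si.
exists E, x, y; split=> [|i j h l m /word w0]; first by split.
pose n := (i + j + p ^ (be - si) * h)%N.
have /shift_relP[] // : N ^+ 2 *+ n + N ^+ 3 *+ (h + l + m) = 0.
  by rewrite /n -[LHS]opprK -[RHS]oppr0 -w0; congr (- _); ring.
by rewrite !mul1n.
Qed.

End Models.

(** * Parametrisation of gamma_3 by a direct sum of cyclic groups *)

Section CyclicExponents.

Lemma expg_mod_order (Q : groupType) (z : Q) r n :
  z ^+ r = 1 -> z ^+ (n %% r) = z ^+ n.
Proof.
move=> zr; rewrite [in RHS](divn_eq n r) expgnDr mulnC expgnA zr.
by rewrite expg1n mul1g.
Qed.

Lemma expg_cyclicM (Q : groupType) (z : Q) r (x y : cyclic_group r) :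
  (0 < r)%N -> z ^+ r = 1 -> z ^+ (x * y)%g = z ^+ x * z ^+ y.
Proof.
move=> r_gt0 zr; rewrite -expgnDr -[RHS](expg_mod_order _ zr).
by congr (_ ^+ (_ %% _)); apply: prednK.
Qed.

Lemma expg_cyclic_inZp (Q : groupType) (z : Q) r n : (0 < r)%N -> z ^+ r = 1 ->
  z ^+ (inZp n : cyclic_group r) = z ^+ n.
Proof.
move=> r_gt0 zr; rewrite -[RHS](expg_mod_order _ zr).
by congr (_ ^+ (_ %% _)); apply: prednK.
Qed.

Lemma cyclic_dvd_eq1 r (x : cyclic_group r) : (0 < r)%N -> (r %| x)%N -> x = 1.
Proof.
move=> r_gt0 rx; apply/val_inj/eqP; rewrite /= -[_ == _]/(x == 0 :> nat).
apply: contraTT rx => x0; rewrite gtnNdvd ?lt0n //.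
by apply: leq_trans (ltn_ord x) _; rewrite prednK.
Qed.

End CyclicExponents.

Lemma mulgACA_commute (Q : groupType) (x y x' y' : Q) : commute y x' ->
  x * y * (x' * y') = x * x' * (y * y').
Proof. by move=> yx'; rewrite -!mulgA; congr (_ * _); rewrite !mulgA yx'. Qed.

Section Gamma3Parametrisation.

Variables (ral rbe rsi P : nat).
Hypotheses (ral_gt0 : (0 < ral)%N) (rbe_gt0 : (0 < rbe)%N).
Hypotheses (rsi_gt0 : (0 < rsi)%N).

Definition multiplier_model : groupType :=
  (cyclic_group ral * cyclic_group rbe * cyclic_power rsi 3)%type.

Variables (Q : groupType) (a b : Q).

Definition model_word (x : multiplier_model) : Q :=
  gamma3_word P x.1.1 x.1.2 (x.2 ord0) (x.2 (inord 1)) (x.2 (inord 2)) a b.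

Hypotheses (u2 : second_center [~ a, b, a]) (w2 : second_center [~ a, b, b]).
Hypotheses (ou : [~ a, b, a] ^+ ral = 1) (ow : [~ a, b, b] ^+ rbe = 1).
Hypothesis ov : ([~ a, b, a, a] * [~ a, b, a] ^+ P) ^+ rsi = 1.
Hypotheses (ot2 : [~ a, b, a, b] ^+ rsi = 1) (ot3 : [~ a, b, b, b] ^+ rsi = 1).

(** All five factors commute: u and w are commutators in the second center, and weight four is
    central. *)
Lemma model_wordM : {morph model_word : x y / x * y}.
Proof.
move=> [[x1 x2] f] [[y1 y2] g]; rewrite /model_word /gamma3_word /=.
rewrite !ffunE !(expg_cyclicM _ _ ral_gt0 ou, expg_cyclicM _ _ rbe_gt0 ow,
  expg_cyclicM _ _ rsi_gt0 ov, expg_cyclicM _ _ rsi_gt0 ot2,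
  expg_cyclicM _ _ rsi_gt0 ot3).
set u := [~ a, b, a]; set w := [~ a, b, b].
have cuw : commute w u by apply: second_center_commute.
have cc z g' (y : Q) : second_center z -> commute [~ z, g'] y.
  by move=> z2; apply: second_center_comm.
have cv (y : Q) : commute y u -> commute ([~ u, a] * u ^+ P) y.
  move=> yu; apply/commute_sym/commuteM; last exact: commuteX.
  exact/commute_sym/cc.
have cX (s s' y : Q) n n' k : commute y s -> commute y s' ->
    commute (y ^+ k) (s ^+ n * s' ^+ n').
  by move=> ys ys'; apply: commuteM; apply: commuteX2.
have ccX z g' n (y : Q) : second_center z -> commute ([~ z, g'] ^+ n) y.
  by move=> z2; apply/commute_sym/commuteX/commute_sym/cc.
rewrite [RHS]mulgACA_commute; last exact: ccX.
congr (_ * _); rewrite [RHS]mulgACA_commute; last exact: ccX.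
congr (_ * _); rewrite [RHS]mulgACA_commute; last by apply: cX; apply: cv.
by congr (_ * _); rewrite [RHS]mulgACA_commute //; apply: commuteX2.
Qed.

Lemma model_wordP i j h l m :
  exists x, model_word x = gamma3_word P i j h l m a b.
Proof.
exists (inZp i, inZp j, [ffun k : 'I_3 => inZp (nth 0 [:: h; l; m] k)]).
rewrite /model_word /gamma3_word /= !ffunE /= !inordK //=.
by rewrite !(expg_cyclic_inZp _ ral_gt0 ou, expg_cyclic_inZp _ rbe_gt0 ow,
  expg_cyclic_inZp _ rsi_gt0 ov, expg_cyclic_inZp _ rsi_gt0 ot2,
  expg_cyclic_inZp _ rsi_gt0 ot3).
Qed.

Lemma model_word_eq1 (x : multiplier_model) :
    (ral %| x.1.1)%N -> (rbe %| x.1.2)%N ->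
    (forall k, (rsi %| x.2 k)%N) -> x = 1.
Proof.
case: x => [[x y] f] /= /(cyclic_dvd_eq1 ral_gt0) ->.
move=> /(cyclic_dvd_eq1 rbe_gt0) -> fP; congr (_, _, _); apply/ffunP=> k.
by rewrite (cyclic_dvd_eq1 rsi_gt0 (fP k)) ffunE.
Qed.

Hypothesis genQ : forall P : Q -> Prop, subgroup P -> P a -> P b ->
  (forall r, second_center r -> P r) -> forall g, P g.
Hypothesis sym : [~ a, b, b, a] = [~ a, b, a, b].

(** The image is a subgroup containing the six generators: [u,a] is the twisted factor times u^(-P),
    and [w,a] = [u,b]. *)
Lemma gamma3_model_word g : gamma3 g -> exists x, model_word x = g.
Proof.
have word_in i j h l m : exists x, model_word x = gamma3_word P i j h l m a b.
  exact: model_wordP.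
have w1 : model_word 1 = 1.
  by apply: (mulgI (model_word 1)); rewrite -model_wordM !mulg1.
have sS : subgroup (fun g => exists x, model_word x = g).
  split=> [|_ _ [x <-] [y <-]]; first by exists 1.
  exists (x * y^-1); rewrite model_wordM; congr (_ * _).
  by apply: (mulgI (model_word y)); rewrite -model_wordM !mulgV.
have wu n : exists x, model_word x = [~ a, b, a] ^+ n.
  have [x xE] := word_in n 0%N 0%N 0%N 0%N; exists x; rewrite xE /gamma3_word.
  by rewrite !expg0 !mulg1.
have Su := wu 1%N; have Swb := word_in 0%N 0%N 0%N 0%N 1%N.
have Sub := word_in 0%N 0%N 0%N 1%N 0%N.
have Sw := word_in 0%N 1%N 0%N 0%N 0%N; have Sv := word_in 0%N 0%N 1%N 0%N 0%N.
move: Sv Su Swb Sub Sw; rewrite /gamma3_word !expg0 !expg1 !mulg1 !mul1g.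
move=> Sv Su Swb Sub Sw.
apply: (triple_comm_sub_gen genQ u2 w2 sS) => //; last by rewrite sym.
by have := sS.2 _ _ Sv (wu P); rewrite mulgK.
Qed.

End Gamma3Parametrisation.

(** * Identification of the multiplier *)

Lemma gmulf_comm_subgroup (F E : groupType) (f : {multiplicative F -> E})
    (A B : F -> Prop) (A' B' : E -> Prop) :
    (forall x, A x -> A' (f x)) -> (forall x, B x -> B' (f x)) ->
  forall x, comm_subgroup A B x -> comm_subgroup A' B' (f x).
Proof.
move=> fA fB x xAB.
have [C1 CF] : subgroup (comm_subgroup A' B') by apply: subgroup_gen_subgroup.
apply: (xAB (fun x => comm_subgroup A' B' (f x))).
  split=> [|y z Cy Cz]; rewrite ?multiplicative1 // gmulfM multiplicativeV.
  exact: CF.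
move=> _ [y [z [Ay Bz ->]]]; rewrite multiplicativeR => C sC; apply.
by exists (f y), (f z); split; [apply: fA | apply: fB |].
Qed.

Lemma gmulf_gamma3 (F E : groupType) (f : {multiplicative F -> E}) x :
  gamma3 x -> gamma3 (f x).
Proof. by do 2?apply: gmulf_comm_subgroup => //. Qed.

Lemma subgroupX (G : groupType) (A : G -> Prop) x n :
  subgroup A -> A x -> A (x ^+ n).
Proof.
move=> sA Ax; elim: n => [|n IHn]; first exact: subgroup1.
by rewrite expgS; apply: subgroupM.
Qed.

Lemma gamma3_word_in (F : groupType) P i j h l m (a b : F) :
  gamma3 (gamma3_word P i j h l m a b).
Proof.
have nF : normal_in (@fullG F) (@fullG F) by [].
have [n2 _] := normal_comm_subgroup nF.
have [[_ s3 _ n3] _] := normal_comm_subgroup n2.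
have {}s3 : subgroup (@gamma3 F) by [].
have {}n3 x y : gamma3 x -> gamma3 (x ^ y : F) by move=> /n3; apply.
have in3 x y z : gamma3 ([~ x, y, z] : F).
  move=> C sC; apply; exists [~ x, y], z; split=> // D sD; apply.
  by exists x, y.
have in4 x y z t : gamma3 ([~ x, y, z, t] : F).
  rewrite commgEl; apply: (subgroupM s3); last by apply: n3; apply: in3.
  by apply: (subgroupV s3); apply: in3.
have sX x n : gamma3 x -> gamma3 (x ^+ n : F) by apply: subgroupX.
have v3 : gamma3 ([~ a, b, a, a] * [~ a, b, a] ^+ P).
  by apply: (subgroupM s3); [apply: in4 | apply: sX; apply: in3].
rewrite /gamma3_word; do 4![apply: (subgroupM s3); last by
  apply: sX; first [exact: v3 | exact: in3 | exact: in4]].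
by apply: sX; apply: in3.
Qed.

Lemma isomorphic_of_bijection (G H Q : groupType) (f : {multiplicative G -> Q})
    (g : {multiplicative H -> Q}) : injective f -> injective g ->
    (forall x, exists y, g y = f x) -> (forall y, exists x, f x = g y) ->
  isomorphic G H.
Proof.
move=> f_inj g_inj /choice[s sE] /choice[t tE].
have sM : {morph s : x y / x * y}.
  by move=> x y; apply: g_inj; rewrite gmulfM !sE gmulfM.
pose s' : {multiplicative G -> H} :=
  HB.pack s (isMultiplicative.Build _ _ s sM).
exists s'.
exists t => [x | y]; first by apply: f_inj; rewrite tE sE.
by apply: g_inj; rewrite sE tE.
Qed.

(** The inclusion of A/B in G/B: the coset is the same subset. *)
Definition widen_quot (G : groupType) (A B : G -> Prop) (nAB : normal_in A B)
    (nB : normal_in fullG B) (C : quot nAB) : quot nB :=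
  Quot nB (let: ex_intro2 x _ xC := quot_setP C in
    ex_intro2 _ (fun y => quot_set C = lcoset_pred B y) x I xC).

Section Main.

Variables (p al be ga si : nat).
Hypotheses (p_odd : odd p) (p_gt1 : (1 < p)%N).
Hypotheses (si_ga : (si <= ga)%N) (ga_be : (ga <= be)%N).
Hypotheses (albe : (al + si = be + ga)%N) (ga_gt0 : (0 < ga)%N).

Variables (G : finGroupType) (F : groupType) (R : F -> Prop).
Variable nR : normal_in fullG R.
Hypothesis freeF : free_group F.
Hypothesis isoG : isomorphic G (quot nR).
Hypothesis presG : presented (p ^ al) (p ^ be) (p ^ ga) (p ^ si) G.

Let P := (p ^ (be - si))%N.

(** Both sides embed in Q = F/[R,F,F] with image gamma_3(Q), the multiplier by [iota] and the direct
    sum by [theta]. *)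
Lemma multiplier_iso : isomorphic (two_nilpotent_multiplier nR)
  (multiplier_model (p ^ al) (p ^ be) (p ^ si)).
Proof.
have [a0 [b0 [genG rel0 univ]]] := presented_universal presG.
have [pi [pi_surj piR]] := isomorphic_projection isoG.
have [[a aE] [b bE]] := (pi_surj a0, pi_surj b0).
have nC : normal_in fullG (commRFF R).
  have [nRF _] := normal_comm_subgroup nR.
  by have [] := normal_comm_subgroup nRF.
pose q : {multiplicative F -> quot nC} := quot_map nC.
have q_eq1 x : q x = 1 <-> commRFF R x by apply: quot_map_eq1.
have q_surj C : exists x, q x = C by apply: quot_map_surj.
have RZ2 r : R r -> second_center (q r).
  move=> Rr C D; have [[f <-] [g <-]] := (q_surj C, q_surj D).
  rewrite -!multiplicativeR; apply/q_eq1 => S sS; apply.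
  by exists [~ r, f], g; split=> // T sT; apply; exists r, f.
pose A := q a; pose B := q b.
have [A2 C2 [u2 w2] B2] : weak_relations p al be ga si A B.
  have qR x : pi x = 1 -> second_center (q x) by move=> /piR/RZ2.
  case: rel0; rewrite -aE -bE => r1 r2 r3 r4 r5; rewrite /A /B.
  split; [| |split|];
    rewrite -?(multiplicativeX q, multiplicativeR q, multiplicativeV q);
    rewrite -?(multiplicativeX q, multiplicativeR q, multiplicativeV q);
    rewrite -?gmulfM; apply: qR; rewrite ?gmulfM;
    rewrite ?(multiplicativeX, multiplicativeR, multiplicativeV) //.
  by rewrite r5 mulgV.
(* F is generated by a, b and R, and R maps into the second center. *)
have genQ (S : quot nC -> Prop) : subgroup S -> S A -> S B ->
    (forall r, second_center r -> S r) -> forall C, S C.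
  move=> sS SA SB SZ C; have [x <-] := q_surj C.
  have [y [xy Sy]] : exists y, pi y = pi x /\ S (q y).
    apply: (gen_ind genG (P := fun g => exists y, pi y = g /\ S (q y))).
      split=> [|_ _ [y [<- Sy]] [z [<- Sz]]].
        by exists 1; rewrite !multiplicative1; split=> //; apply: subgroup1.
      exists (y * z^-1); rewrite !gmulfM !multiplicativeV; split=> //.
      by apply: sS.2.
    by move=> g /set2P[] ->; [exists a | exists b].
  rewrite -(mulKVg y x) gmulfM; apply: (subgroupM sS) => //; apply/SZ/RZ2/piR.
  by rewrite gmulfM multiplicativeV xy mulVg.
have p_gt0 : (0 < p)%N by lia.
have X_gt0 n : (0 < p ^ n)%N by rewrite expn_gt0 p_gt0.
have bin2 n : (p ^ n %| 'C(p ^ n, 2))%N by rewrite dvdn_bin2 // oddX p_odd orbT.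
have [||ou ow [ot2 ot3] ot1 sym] :=
    weight4_relations A2 C2 u2 w2 B2 (bin2 al) (bin2 be).
- by rewrite dvdn_exp2l //; lia.
- by rewrite dvdn_exp2l.
(* As P p^si = p^be, this is the relation [ot1]. *)
have ov : ([~ A, B, A, A] * [~ A, B, A] ^+ P) ^+ (p ^ si) = 1.
  rewrite expgMn; last by apply: second_center_comm.
  rewrite -expgnA /P -expnD subnK; last by lia.
  rewrite -ot1; apply/commute_sym/commuteX/commute_sym/commuteX.
  exact: second_center_comm.
pose theta := @model_word (p ^ al) (p ^ be) (p ^ si) P _ A B.
have thetaM : {morph theta : x y / x * y} by apply: model_wordM.
pose theta' : {multiplicative
    multiplier_model (p ^ al) (p ^ be) (p ^ si) -> quot nC} :=
  HB.pack theta (isMultiplicative.Build _ _ theta thetaM).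
have detect D : detects p al be ga si D ->
    forall i j h l m, commRFF R (gamma3_word P i j h l m a b) -> D i j h l m.
  move=> [E [x [y [[x2 c2 [xu2 xw2] y2] xyD]]]] i j h l m wC.
  rewrite -aE -bE in univ.
  have [phi [phiR [z z2 az] [z' z2' bz]]] :=
    lift_mod_second_center freeF piR univ x2 c2 xu2 xw2 y2.
  apply: xyD; rewrite -(gamma3_word_mod _ _ _ _ _ _ x y z2 z2') -az -bz.
  by rewrite -gmulf_gamma3_word; apply: commRFF_kernel wC.
have theta_eq1 x : theta x = 1 -> x = 1.
  rewrite /theta /model_word -gmulf_gamma3_word => /q_eq1 wC.
  have [di dh] := detect _ (model_u_t1 p_odd p_gt1 si_ga ga_be albe ga_gt0)
    _ _ _ _ _ wC.
  have dj := detect _ (model_w p_odd p_gt1 si_ga ga_be albe ga_gt0)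
    _ _ _ _ _ wC.
  have dm := detect _ (model_t3 p_odd p_gt1 si_ga ga_be albe ga_gt0)
    _ _ _ _ _ wC.
  have := detect _ (model_t2 p_odd p_gt1 si_ga ga_be albe ga_gt0) _ _ _ _ _ wC.
  rewrite dvdn_addl // dvdn_addr // => dl.
  apply: model_word_eq1 => // k; case: k => [[|[|[|//]]] k3].
  - by rewrite (_ : Ordinal k3 = ord0) //; apply: val_inj.
  - by rewrite (_ : Ordinal k3 = inord 1) //; apply: val_inj; rewrite /= inordK.
  - by rewrite (_ : Ordinal k3 = inord 2) //; apply: val_inj; rewrite /= inordK.
have theta_inj : injective theta'.
  move=> x y /= xy; apply: divg1_eq; apply: theta_eq1.
  by rewrite -[theta]/(theta' : _ -> _) gmulfM multiplicativeV /= xy mulgV.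
(* The relations [a,b,a] = [a,b,b] = 1 of G kill every word. *)
have word_R i j h l m : R (gamma3_word P i j h l m a b).
  apply/piR; rewrite gmulf_gamma3_word aE bE.
  case: rel0 => _ _ r3 r4 _.
  by rewrite /gamma3_word r3 r4 !comm1g !(expg1n, mulg1).
pose iota (C : two_nilpotent_multiplier nR) := widen_quot nC C.
have iotaM : {morph iota : x y / x * y}.
  by move=> x y; apply: quot_inj.
pose iota' : {multiplicative two_nilpotent_multiplier nR -> quot nC} :=
  HB.pack iota (isMultiplicative.Build _ _ iota iotaM).
apply: (@isomorphic_of_bijection _ _ _ iota' theta') => //.
- by move=> x y /(congr1 (@quot_set _ _ _ _)) xy; apply: quot_inj.
- move=> C; have [x [Rx x3] xC] := quot_setP C.
  have [y yE] : exists y, theta y = q x.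
    apply: gamma3_model_word genQ sym _ _ => //; exact: gmulf_gamma3.
  by exists y; rewrite /= yE; apply: quot_inj; rewrite /= xC.
- move=> y; set x := gamma3_word P y.1.1 y.1.2 (y.2 ord0) (y.2 (inord 1))
    (y.2 (inord 2)) a b.
  have Rx3 : R x /\ gamma3 x by split; [apply: word_R | apply: gamma3_word_in].
  exists (Quot (commRFF_normal nR) (ex_intro2 _
    (fun z => lcoset_pred (commRFF R) x = lcoset_pred (commRFF R) z)
    x Rx3 erefl)).
  have -> : theta' y = q x by rewrite gmulf_gamma3_word.
  exact: quot_inj.
Qed.
End Main.

(** * Regrouping direct sums and unfolding the given presentations *)

Lemma isomorphic_intro (G H : groupType) (f : G -> H) (g : H -> G) :
  {morph f : x y / x * y} -> cancel f g -> cancel g f -> isomorphic G H.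
Proof.
move=> fM fK gK.
pose f' : {multiplicative G -> H} := HB.pack f (isMultiplicative.Build _ _ f fM).
by exists f', g.
Qed.

Lemma isomorphic_trans (G H K : groupType) :
  isomorphic G H -> isomorphic H K -> isomorphic G K.
Proof.
move=> [f [f' fK f'K]] [g [g' gK g'K]].
apply: (@isomorphic_intro _ _ (g \o f) (f' \o g')); first exact: gmulfM.
  exact: can_comp.
exact: can_comp.
Qed.

Lemma isomorphic_mull (G H K : groupType) :
  isomorphic G H -> isomorphic (G * K)%type (H * K)%type.
Proof.
move=> [f [g fK gK]].
apply: (@isomorphic_intro _ _ (fun x => (f x.1, x.2)) (fun x => (g x.1, x.2))).
- by move=> [x k] [y l]; congr (_, _); apply: gmulfM.
- by move=> [x k] /=; rewrite fK.
- by move=> [x k] /=; rewrite gK.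
Qed.

Lemma isomorphic_cyclic_pair r :
  isomorphic (cyclic_group r * cyclic_group r)%type (cyclic_power r 2).
Proof.
apply: (@isomorphic_intro _ _
  (fun x => [ffun k : 'I_2 => if k == ord0 then x.1 else x.2])
  (fun g => (g ord0, g ord_max))).
- by move=> x y; apply/ffunP=> k; rewrite !ffunE; case: ifP.
- by move=> [x y]; rewrite !ffunE.
move=> g; apply/ffunP=> k; rewrite ffunE /=; case: eqVneq => [-> //|].
by case: k => [[|[|//]] k2] // _; congr (g _); apply: val_inj.
Qed.

Lemma isomorphic_cyclic_powerD r m n :
  isomorphic (cyclic_power r m * cyclic_power r n)%type (cyclic_power r (m + n)).
Proof.
pose f (x : cyclic_power r m * cyclic_power r n) : cyclic_power r (m + n) :=
  [ffun k => match split k with inl i => x.1 i | inr j => x.2 j end].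
pose f' (g : cyclic_power r (m + n)) : cyclic_power r m * cyclic_power r n :=
  ([ffun i => g (lshift n i)], [ffun j => g (rshift m j)]).
apply: (@isomorphic_intro _ _ f f').
- by move=> x y; apply/ffunP=> k; rewrite !ffunE; case: split => i; rewrite ffunE.
- move=> [x y]; congr (_, _); apply/ffunP=> k; rewrite !ffunE.
    by rewrite -[lshift n k]/(unsplit (inl k)) unsplitK.
  by rewrite -[rshift m k]/(unsplit (inr k)) unsplitK.
move=> g; apply/ffunP=> k; rewrite ffunE.
by case: split_ordP => i ->; rewrite ffunE.
Qed.

(** Given [[~ a, b] ^+ m = 1], the relation [b ^+ n = 1] is the twisted one with exponent [m]. *)
Lemma presented_diagonal (G : finGroupType) n m :
    [set: G] \isog Grp (a : b : [~ a, b] ^+ m, a ^+ n, b ^+ n,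
      [~ a, b, b], [~ a, b, a]) ->
  presented n n m m G.
Proof.
move=> isoG rT H; rewrite isoG; split.
  case/existsP=> [[x y]] /=; rewrite !xpair_eqE => /andP[/eqP genH rel].
  exists x, y; split; first by rewrite -genH joing_idl joing_idr.
  case/and5P: rel => /eqP r1 /eqP r2 /eqP r3 /eqP r4 /eqP r5.
  by split; rewrite ?r1.
move=> [x [y [genH [r1 r2 r3 r4 r5]]]].
have genH' : <[x]> <*> <[y]> = H by rewrite joing_idl joing_idr.
apply/existsP; exists (x, y); rewrite /= !xpair_eqE genH'.
by rewrite r5 r1 r2 r3 r4 !eqxx.
Qed.

Lemma presented_twisted (G : finGroupType) n m r s :
    [set: G] \isog Grp (a : b : [~ a, b] ^+ m, a ^+ n,
      [~ a, b, b], [~ a, b, a], b ^+ r = [~ a, b] ^+ s) ->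
  presented n r m s G.
Proof.
move=> isoG rT H; rewrite isoG; split.
  case/existsP=> [[x y]] /=; rewrite !xpair_eqE => /andP[/eqP genH rel].
  exists x, y; split; first by rewrite -genH joing_idl joing_idr.
  by case/and5P: rel => /eqP r1 /eqP r2 /eqP r3 /eqP r4 /eqP r5; split.
move=> [x [y [genH [r1 r2 r3 r4 r5]]]].
have genH' : <[x]> <*> <[y]> = H by rewrite joing_idl joing_idr.
apply/existsP; exists (x, y); rewrite /= !xpair_eqE genH'.
by rewrite r5 r1 r2 r3 r4 !eqxx.
Qed.

Theorem theoremA (p : nat) (G : finGroupType)
    (F : groupType) (R : F -> Prop) (nR : normal_in fullG R) :
  prime p -> odd p ->
  p.-group [set: G] ->
  (exists x y : G, <<[set x; y]>> = [set: G]) ->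
  nil_class [set: G] = 2 ->
  capable G ->
  free_group F ->
  isomorphic G (quot nR) ->
  [/\ forall alpha : nat, (1 <= alpha)%N ->
        [set: G] \isog Grp (a : b :
          [~ a, b] ^+ (p ^ alpha)%N, a ^+ (p ^ alpha)%N, b ^+ (p ^ alpha)%N,
          [~ a, b, b], [~ a, b, a]) ->
        isomorphic (two_nilpotent_multiplier nR) (cyclic_power (p ^ alpha) 5),

      forall alpha gamma : nat, (gamma < alpha)%N -> (1 <= gamma)%N ->
        [set: G] \isog Grp (a : b :
          [~ a, b] ^+ (p ^ gamma)%N, a ^+ (p ^ alpha)%N, b ^+ (p ^ alpha)%N,
          [~ a, b, b], [~ a, b, a]) ->
        isomorphic (two_nilpotent_multiplier nR)
          (cyclic_power (p ^ alpha) 2 * cyclic_power (p ^ gamma) 3)%type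

    & forall alpha beta gamma sigma : nat,
        (beta <= alpha)%N -> (gamma <= beta)%N -> (1 <= gamma)%N ->
        (alpha - beta = gamma - sigma)%N -> (sigma < gamma)%N ->
        [set: G] \isog Grp (a : b :
          [~ a, b] ^+ (p ^ gamma)%N, a ^+ (p ^ alpha)%N,
          [~ a, b, b], [~ a, b, a],
          b ^+ (p ^ beta)%N = [~ a, b] ^+ (p ^ sigma)%N) ->
        isomorphic (two_nilpotent_multiplier nR)
          (cyclic_group (p ^ alpha) * cyclic_group (p ^ beta)
           * cyclic_power (p ^ sigma) 3)%type].
Proof.
move=> p_pr p_odd _ _ _ _ freeF isoG; have p_gt1 := prime_gt1 p_pr.
(* The inequality is weak so that gamma = alpha covers presentation (i). *)
have iso_ii alpha gamma : (gamma <= alpha)%N -> (1 <= gamma)%N ->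
    [set: G] \isog Grp (a : b : [~ a, b] ^+ (p ^ gamma)%N,
      a ^+ (p ^ alpha)%N, b ^+ (p ^ alpha)%N, [~ a, b, b], [~ a, b, a]) ->
    isomorphic (two_nilpotent_multiplier nR)
      (cyclic_power (p ^ alpha) 2 * cyclic_power (p ^ gamma) 3)%type.
  move=> ga_al ga_gt0 /presented_diagonal presG.
  apply: isomorphic_trans (isomorphic_mull _ (isomorphic_cyclic_pair _)).
  exact: (multiplier_iso p_odd p_gt1 (leqnn gamma) ga_al (erefl _) ga_gt0
    freeF isoG presG).
split=> [alpha al_gt0 presG | alpha gamma /ltnW | ]; last 2 first.
- exact: iso_ii.
- move=> alpha beta gamma sigma be_al ga_be ga_gt0 albe si_ga.
  move=> /presented_twisted presG.
  have e : (alpha + sigma = beta + gamma)%N by lia.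
  exact: (multiplier_iso p_odd p_gt1 (ltnW si_ga) ga_be e ga_gt0 freeF
    isoG presG).
apply: isomorphic_trans (isomorphic_cyclic_powerD _ 2 3).
exact: iso_ii (leqnn alpha) al_gt0 presG.
Qed.
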